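(* Let $T$ be a skew field, $m\geqslant 1$, and let $R=\mathrm{M}(m,T)$ be the full matrix ring over $T$, where $R$ is not (isomorphic to) any of the rings $\mathbb{F}_2,\mathbb{F}_3,\mathbb{F}_4,\mathbb{F}_5,\mathrm{M}(2,\mathbb{F}_2)$. Let $n\geqslant 2$, let $M$ be a free right $R$-module of rank $n$ with basis $\bar e_1,\ldots,\bar e_n$, let $L$ be the lattice of right submodules of $M$, let $L_0$ be the sublattice of $L$ generated by the submodules $e_i=\bar e_iR$, $i=1,\ldots,n$, let $G=\mathrm{Aut}(L)$ be the group of all automorphisms of the lattice $L$, and let $H=G(L_0)$. Then for every subgroup $F$ with $H\leqslant F\leqslant G$ there exists a unique $D$-net $\sigma$ of two-sided ideals in $R$ of order $n$ such that $$G(K_\sigma)\leqslant F\leqslant \mathcal{N}_G\,G(K_\sigma),$$ where $K_\sigma$ is the sublattice of $L$ associated with the transposed collection $\sigma^{\mathrm T}$, and $\mathcal{N}_G\,G(K_\sigma)$ is the normaliser of $G(K_\sigma)$ in $G$.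
   Context: Rings are associative with $1$. $\mathbb{F}_q$ denotes the field of $q$ elements. The operations of $L$ are sum and intersection of submodules. For a subset (in particular a sublattice) $N\subseteq L$, $G(N)=\{g\in G : g(x)=x \text{ for every } x\in N\}$ (pointwise stabiliser). A $D$-net of two-sided ideals in $R$ of order $n$ is a collection $\sigma=(\sigma_{ij})_{i,j=1}^n$ of two-sided ideals of $R$ such that $\sigma_{ir}\sigma_{rj}\subseteq\sigma_{ij}$ for all $i,r,j$ and $\sigma_{ii}=R$ for all $i$. For a $D$-net $\sigma$, the transposed collection $\sigma^{\mathrm T}$ has entries $(\sigma^{\mathrm T})_{ij}=\sigma_{ji}$, and $(\sigma^{\mathrm T})_{ij}$ is regarded as the submodule $\bar e_j\sigma_{ji}$ of $e_j=\bar e_jR$. For a collection $\tau=(\tau_{ij})$ of elements of $L$ with $\tau_{ij}\leqslant e_j$, the lattice associated with $\tau$ is the sublattice of $L$ generated by the elements $\sum_{j=1}^n\tau_{ij}$, $i=1,\ldots,n$. Thus $K_\sigma$ is the sublattice of $L$ generated by the submodules $\sum_{j=1}^n\bar e_j\sigma_{ji}$, $i=1,\ldots,n$. *)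

(* Defs.v *)
From HB Require Import structures.
From mathcomp Require Import all_boot all_order all_algebra.
From mathcomp Require Import boolp classical_sets.

Set Implicit Arguments.
Unset Strict Implicit.
Unset Printing Implicit Defensive.

Import Order.TTheory GRing.Theory.
Local Open Scope classical_set_scope.
Local Open Scope ring_scope.

Local Notation "R ^c" := (GRing.converse R) : type_scope.

Section Lattices.
Context {d : Order.disp_t}.

Definition sublattice {L : latticeType d} (N : set L) : Prop :=
  forall x y, N x -> N y -> N (Order.meet x y) /\ N (Order.join x y).

Definition sublattice_gen {L : latticeType d} (X : set L) : set L :=
  smallest sublattice X.

Definition assoc_lattice {L : bLatticeType d} (n : nat)
    (tau : 'I_n -> 'I_n -> L) : set L :=
  sublattice_gen (range (fun i => \join_(j < n) tau i j)%O).

Record latAut (L : latticeType d) := LatAut {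
  aut_fun :> L -> L;
  aut_inv : L -> L;
  aut_funK : cancel aut_fun aut_inv;
  aut_invK : cancel aut_inv aut_fun;
  aut_meet : Order.meet_morphism aut_fun;
  aut_join : Order.join_morphism aut_fun }.

Section AutGroup.
Variable L : latticeType d.
Implicit Types f g h : latAut L.

Lemma latAut_ext f g : f =1 g -> f = g.
Proof.
case: f g => [f f' fK f'K fM fJ] [g g' gK g'K gM gJ] /= /funext fg.
have fg' : f' = g'.
  by subst g; apply/funext => x; rewrite -{1}[x]g'K fK.
by subst g g'; congr LatAut; apply: Prop_irrelevance.
Qed.

HB.instance Definition _ := gen_eqMixin (latAut L).
HB.instance Definition _ := gen_choiceMixin (latAut L).

Definition latAut_one : latAut L :=
  @LatAut L id id (fun=> erefl) (fun=> erefl)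
    (fun _ _ => erefl) (fun _ _ => erefl).

Fact latAut_inv_meet f : Order.meet_morphism (aut_inv f).
Proof.
by move=> x y; apply: (can_inj (aut_funK f)); rewrite aut_meet !aut_invK.
Qed.

Fact latAut_inv_join f : Order.join_morphism (aut_inv f).
Proof.
by move=> x y; apply: (can_inj (aut_funK f)); rewrite aut_join !aut_invK.
Qed.

Definition latAut_inv f : latAut L :=
  LatAut (aut_invK f) (aut_funK f) (@latAut_inv_meet f) (@latAut_inv_join f).

Fact latAut_mul_meet f g : Order.meet_morphism (f \o g).
Proof. by move=> x y /=; rewrite !aut_meet. Qed.

Fact latAut_mul_join f g : Order.join_morphism (f \o g).
Proof. by move=> x y /=; rewrite !aut_join. Qed.

Definition latAut_mul f g : latAut L :=
  LatAut (can_comp (aut_funK f) (aut_funK g))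
         (can_comp (aut_invK g) (aut_invK f))
         (@latAut_mul_meet f g) (@latAut_mul_join f g).

Fact latAut_mulA : associative latAut_mul.
Proof. by move=> f g h; apply: latAut_ext. Qed.
Fact latAut_mul1 : left_id latAut_one latAut_mul.
Proof. by move=> f; apply: latAut_ext. Qed.
Fact latAut_1mul : right_id latAut_one latAut_mul.
Proof. by move=> f; apply: latAut_ext. Qed.
Fact latAut_mulV : left_inverse latAut_one latAut_inv latAut_mul.
Proof. by move=> f; apply: latAut_ext => x /=; rewrite aut_funK. Qed.
Fact latAut_Vmul : right_inverse latAut_one latAut_inv latAut_mul.
Proof. by move=> f; apply: latAut_ext => x /=; rewrite aut_invK. Qed.

HB.instance Definition _ := isGroup.Build (latAut L)
  latAut_mulA latAut_mul1 latAut_1mul latAut_mulV latAut_Vmul.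

Definition pstab (N : set L) : set (latAut L) :=
  [set g | forall x, N x -> g x = x].

End AutGroup.
End Lattices.

Definition subgroup (G : groupType) (F : set G) : Prop := group_closed [in F].

Definition normaliser (G : groupType) (A : set G) : set G :=
  [set g | [set (x ^ g)%g | x in A] = A].

Section TwoSidedIdeals.
Variable R : pzRingType.

Definition ideal_closed (I : set R) : Prop :=
  zmod_closed [in I] /\
  forall r x, x \in I -> r * x \in I /\ x * r \in I.

Record ideal := Ideal {
  ideal_set :> set R;
  idealP : ideal_closed ideal_set }.

Fact setT_ideal_closed : ideal_closed [set: R].
Proof.
by split=> [|r x _]; [split=> [|x y _ _]|split]; rewrite !inE.
Qed.

Definition idealT : ideal := Ideal setT_ideal_closed.

Definition ideal_prod (I J : set R) : set R :=
  [set x | exists k (a b : 'I_k -> R),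
     (forall i, I (a i) /\ J (b i)) /\ x = \sum_(i < k) a i * b i].

Definition Dnet (n : nat) (sigma : 'I_n -> 'I_n -> ideal) : Prop :=
  (forall i r j, ideal_prod (sigma i r) (sigma r j) `<=` sigma i j) /\
  (forall i, sigma i i = idealT).

Definition transpose_net (n : nat) (sigma : 'I_n -> 'I_n -> ideal) :
  'I_n -> 'I_n -> ideal := fun i j => sigma j i.

End TwoSidedIdeals.

(* A right R-module is a left module over the converse ring R^c: the element  *)
(* (a : R^c) *: v stands for v a.                                             *)
Section Submodules.
Variables (R : pzRingType) (M : lmodType R^c).

Lemma submod_closedP (X : set M) : submod_closed [in X] <->
  X 0 /\ forall a u v, X u -> X v -> X (a *: u + v).
Proof.
split=> -[X0 Xl]; split.
- exact: set_mem.
- by move=> a u v Xu Xv; apply: set_mem; apply: Xl; apply: mem_set.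
- exact: mem_set.
- by move=> a u v /set_mem Xu /set_mem Xv; apply: mem_set; apply: Xl.
Qed.

Record submod := Submod {
  submod_set :> set M;
  submodP : submod_closed [in submod_set] }.

Implicit Types A B C : submod.

Lemma submod_mem0 A : (A : set M) 0.
Proof. by have /submod_closedP[] := submodP A. Qed.

Lemma submod_lin A a u v :
  (A : set M) u -> (A : set M) v -> (A : set M) (a *: u + v).
Proof. by have /submod_closedP[_] := submodP A; apply. Qed.

Lemma submod_ext A B : A = B :> set M -> A = B.
Proof.
case: A B => [A pA] [B pB] /= eAB; subst B.
by congr Submod; apply: Prop_irrelevance.
Qed.

HB.instance Definition _ := gen_eqMixin submod.
HB.instance Definition _ := gen_choiceMixin submod.

Fact submodI_closed A B : submod_closed [in A `&` B].
Proof.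
apply/submod_closedP; split=> [|a u v [Au Bu] [Av Bv]].
  by split; apply: submod_mem0.
by split; apply: submod_lin.
Qed.

Definition submodI A B : submod := Submod (submodI_closed A B).

Fact submodD_closed A B :
  submod_closed [in [set u + v | u in (A : set M) & v in (B : set M)]].
Proof.
apply/submod_closedP; split=> [|a _ _ [u Au [v Bv <-]] [u' Au' [v' Bv' <-]]].
  exists 0; first exact: submod_mem0.
  by exists 0; [exact: submod_mem0|exact: addr0].
exists (a *: u + u'); first exact: submod_lin.
exists (a *: v + v'); first exact: submod_lin.
by rewrite scalerDr addrACA.
Qed.

Definition submodD A B : submod := Submod (submodD_closed A B).

Definition submod_le A B := `[< (A : set M) `<=` B >].

Fact submod_le_refl : reflexive submod_le.
Proof. by move=> A; apply/asboolP. Qed.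
Fact submod_le_anti : antisymmetric submod_le.
Proof.
by move=> A B /andP[/asboolP AB /asboolP BA]; apply/submod_ext/seteqP; split.
Qed.
Fact submod_le_trans : transitive submod_le.
Proof.
by move=> B A C /asboolP AB /asboolP BC; apply/asboolP/(subset_trans AB).
Qed.

Fact submod_display : Order.disp_t. Proof. by []. Qed.

HB.instance Definition _ := Order.Le_isPOrder.Build submod_display submod
  submod_le_refl submod_le_anti submod_le_trans.

Fact submodIP A B C : (A <= submodI B C)%O = (A <= B)%O && (A <= C)%O.
Proof.
apply/asboolP/andP => [AI|[/asboolP AB /asboolP AC] x Ax].
  by split; apply/asboolP => x /AI[].
by split; [apply: AB|apply: AC].
Qed.

Fact submodDP A B C : (submodD A B <= C)%O = (A <= C)%O && (B <= C)%O.
Proof.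
apply/asboolP/andP => [DC|[/asboolP AC /asboolP BC] _ [u Au [v Bv <-]]].
  split; apply/asboolP => x xP; apply: DC.
    by exists x => //; exists 0; [exact: submod_mem0|exact: addr0].
  by exists 0; [exact: submod_mem0|exists x => //; exact: add0r].
by rewrite -[u]scale1r; apply: submod_lin; [apply: AC|apply: BC].
Qed.

HB.instance Definition _ :=
  Order.POrder_MeetJoin_isLattice.Build submod_display submod
    submodIP submodDP.

Fact submod0_closed : submod_closed [in [set 0 : M]].
Proof.
apply/submod_closedP; split=> // a _ _ -> ->.
by rewrite scaler0 addr0.
Qed.

Definition submod0 : submod := Submod submod0_closed.

Fact submod_le0 A : (submod0 <= A)%O.
Proof. by apply/asboolP => _ ->; apply: submod_mem0. Qed.

HB.instance Definition _ :=
  Order.hasBottom.Build submod_display submod submod_le0.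

Fact smul_closed (v : M) (I : ideal R) :
  submod_closed [in [set (a : R^c) *: v | a in (I : set R)]].
Proof.
have [[I0 IB] Im] := idealP I.
apply/submod_closedP; split=> [|b _ _ [a1 Ia1 <-] [a2 Ia2 <-]].
  by exists 0; [exact: set_mem|exact: scale0r].
exists (a1 * (b : R) + a2); last by rewrite scalerA -scalerDl.
have Iab : a1 * (b : R) \in [in (I : set R)] by have [] := Im b a1 (mem_set Ia1).
have IN : 0 - a2 \in [in (I : set R)] by apply: IB => //; apply: mem_set.
by apply: set_mem; rewrite -[a2]opprK -[- a2]sub0r; apply: IB.
Qed.

(* v I, a submodule even for a single vector v since I is a right ideal. *)
Definition smul (v : M) (I : ideal R) : submod := Submod (smul_closed v I).

Variables (n : nat) (e : 'I_n -> M).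

Definition is_basis : Prop :=
  forall v : M, exists! c : 'I_n -> R, v = \sum_(i < n) (c i : R^c) *: e i.

Definition L0 : set submod :=
  sublattice_gen (range (fun i => smul (e i) (idealT R))).

Definition K (sigma : 'I_n -> 'I_n -> ideal R) : set submod :=
  assoc_lattice (fun i j => smul (e j) (transpose_net sigma i j)).

End Submodules.

Definition ring_isomorphic (R S : pzRingType) : Prop :=
  exists f : {rmorphism R -> S}, bijective f.

(* F_q is represented by an arbitrary field with q elements, as the library   *)
(* has no canonical type for the field with 4 elements.                       *)
Definition exceptional_ring (R : pzRingType) : Prop :=
  (exists F : finFieldType,
     #|F| \in [:: 2; 3; 4; 5]%N /\ ring_isomorphic R F) \/
  (exists F : finFieldType, #|F| = 2%N /\ ring_isomorphic R 'M[F]_2).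

(* Main.v *)
Require Import Defs.
From HB Require Import structures.
From mathcomp Require Import all_boot all_order all_algebra finfield.
From mathcomp Require Import boolp classical_sets.

Set Implicit Arguments.
Unset Strict Implicit.
Unset Printing Implicit Defensive.

Import Order.TTheory GRing.Theory.
Local Open Scope classical_set_scope.
Local Open Scope ring_scope.

(** Why the theorem holds.

Put S = R^c, so that M is a left S-module. The only two-sided ideals of R are 0
and R, so a D-net amounts to a preorder on the indices (i below j when
sigma i j = R), and K_sigma is generated by the coordinate submodules
S_s = sum of the e_j R over the j below s. To a subgroup F between H and G
attach the preorder netrel: i is below j when F contains all the elementary
transvections e_j |-> e_j + e_i x; it is transitive by the commutator relations.

G(K_sigma) <= F (fixdown_sub, net_lower). An automorphism g of the lattice that
fixes every S_s is brought by Gaussian elimination, using only transvections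
allowed by the preorder, to an automorphism fixing every e_k R. The
elimination acts on the submodules g (e_k R), not on matrix entries, so nothing
has to be known about the form of g. Dimension counts are replaced by chain
conditions (strict_fix, strict_fix0).

F normalises G(K_sigma) (moved_down, net_upper). It suffices that every g in F
permutes the S_s. The key point is elementary_of_moved_axis: if i <> j, if
g (e_k R) has a nonzero i-th coordinate, and if e_j is not in the image by g of
the sum of the other e_l R, then i is below j. Indeed F contains g H g^-1, hence
all the linear automorphisms that act on g (e_k R) and are trivial on its
complement; commutators with the block diagonal maps in H extract from them a
nontrivial elementary transvection, and one coefficient gives all of them since
R is simple and spanned by its units. Given s, choose j such that g (e_s R) has
a nonzero j-th coordinate and e_j is outside the image of the complement of
e_s R; the key point yields g (S_s) <= S_j, and its application to g^-1 yields
the reverse inclusion.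

Uniqueness (net_le_of_sandwich). If two nets fit the same F, the transvections of
one normalise the stabiliser attached to the other, and a block diagonal map
detects the corresponding entry of the other net.

Only linear elements of H and of its conjugates are used, besides g as a lattice
automorphism. Hence the fundamental theorem of projective geometry is not
involved, and the case m = 1, n = 2, where G is a full symmetric group, needs no
separate treatment. The excluded rings are those over which the scalars or
covectors needed in the commutators may fail to exist: for m = 1 the proof picks
scalars outside sets of at most six elements (full_pair_elementary), for m >= 2
it needs two covectors killing a given vector (elementary_higher_rank). *)

Local Notation "R ^c" := (GRing.converse R) : type_scope.

(** * Lattice automorphisms and subgroups *)

Section LatticeAutomorphisms.
Context {d : Order.disp_t} {L : latticeType d}.
Implicit Types (g h : latAut L) (x y : L).

Lemma aut_leE g x y : (g x <= g y)%O = (x <= y)%O.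
Proof.
apply/idP/idP => [/meet_idPl|/meet_idPl xy]; last by apply/meet_idPl; rewrite -aut_meet xy.
by rewrite -aut_meet => /(can_inj (aut_funK g)) xy; apply/meet_idPl.
Qed.

Lemma aut_mulE g h x : (g * h)%g x = g (h x). Proof. by []. Qed.
Lemma aut_invKE g x : g^-1%g (g x) = x. Proof. exact: aut_funK. Qed.
Lemma aut_KinvE g x : g (g^-1%g x) = x. Proof. exact: aut_invK. Qed.

Lemma pstab_gen (X : set L) g :
  (forall x, X x -> g x = x) -> pstab (sublattice_gen X) g.
Proof.
move=> gX x /(_ [set y | g y = y]); apply; split => // y z /= gy gz.
by rewrite aut_meet aut_join gy gz.
Qed.

Lemma sub_gen (X : set L) x : X x -> sublattice_gen X x.
Proof. by move=> Xx Y [_]; apply. Qed.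
End LatticeAutomorphisms.

Lemma aut_bot {d : Order.disp_t} (L : bLatticeType d) (g : latAut L) :
  g \bot%O = \bot%O.
Proof.
by apply/le_anti; rewrite le0x andbT -{2}(aut_KinvE g \bot%O) aut_leE le0x.
Qed.

Lemma aut_bigjoin {d : Order.disp_t} (L : bLatticeType d) (g : latAut L)
    (I : Type) (r : seq I) (P : pred I) (f : I -> L) :
  g (\join_(i <- r | P i) f i)%O = (\join_(i <- r | P i) g (f i))%O.
Proof. by apply: (big_morph g (aut_join g) (aut_bot g)). Qed.

Section SubgroupFacts.
Variables (G : groupType) (F : set G).
Hypothesis hF : subgroup F.

Lemma subgroup1 : F 1%g. Proof. by apply: set_mem; case: hF. Qed.
Lemma subgroupV g : F g -> F g^-1%g.
Proof. by move=> /mem_set gF; apply/set_mem/(group_closedV hF). Qed.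
Lemma subgroupM g h : F g -> F h -> F (g * h)%g.
Proof. by move=> /mem_set gF /mem_set hhF; apply/set_mem/(group_closedM hF). Qed.
End SubgroupFacts.

(** * Submodules, linear forms and the maps x + phi(x) v *)

Definition submod_mem (R : pzRingType) (M : lmodType R^c) (A : submod M) (x : M) :=
  submod_set A x.
Coercion submod_mem : submod >-> Funclass.

Section Submodules.
Variables (R : pzRingType) (M : lmodType R^c).
Implicit Types (A B C : submod M) (x y v : M) (f : M -> M).

Lemma submod_leP A B : (A <= B)%O <-> (forall x, A x -> B x).
Proof. by split=> [/asboolP|AB]; [|apply/asboolP]. Qed.
Lemma submod_le_mem A B x : (A <= B)%O -> A x -> B x.
Proof. by move=> /submod_leP; apply. Qed.
Lemma submod_meetP A B x : (A `&` B)%O x <-> A x /\ B x. Proof. by []. Qed.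
Lemma submod_joinP A B x : (A `|` B)%O x <-> exists u v, [/\ A u, B v & x = u + v].
Proof.
split=> [[u Au [v Bv <-]]|[u [v [Au Bv ->]]]]; first by exists u, v.
by exists u => //; exists v.
Qed.
Lemma submod_botP x : (\bot%O : submod M) x <-> x = 0. Proof. by []. Qed.

Lemma submod_scale A a x : A x -> A (a *: x).
Proof. by move=> Ax; rewrite -[_ *: _]addr0; apply: submod_lin => //; apply: submod_mem0. Qed.
Lemma submod_add A x y : A x -> A y -> A (x + y).
Proof. by move=> Ax Ay; rewrite -[x]scale1r; apply: submod_lin. Qed.
Lemma submod_opp A x : A x -> A (- x).
Proof. by move=> Ax; rewrite -scaleN1r; apply: submod_scale. Qed.
Lemma submod_sub A x y : A x -> A y -> A (x - y).
Proof. by move=> Ax Ay; apply: submod_add => //; apply: submod_opp. Qed.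
Lemma submod_sum A (I : Type) (r : seq I) (P : pred I) (F : I -> M) :
  (forall i, P i -> A (F i)) -> A (\sum_(i <- r | P i) F i).
Proof.
move=> AF; elim/big_ind: _ => //; first exact: submod_mem0.
by move=> x y; apply: submod_add.
Qed.

Lemma submod_eqP A B : (forall x, A x <-> B x) -> A = B.
Proof. by move=> AB; apply/submod_ext/seteqP; split=> x /AB. Qed.

(** The lattice of submodules is modular; both counting arguments on
complements below rest on this law. *)
Lemma submod_modular A B C : (A <= C)%O -> ((A `|` B) `&` C)%O = (A `|` (B `&` C))%O.
Proof.
move=> /submod_leP AC; apply: submod_eqP => x; split.
- move=> [[u Au [w Bw <-]] Cx]; exists u => //; exists w => //; split => //.
  by rewrite -[w](addKr u); apply: submod_add => //; apply/submod_opp/AC.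
- move=> [u Au [w [Bw Cw] <-]]; split; last by apply: submod_add => //; apply: AC.
  by exists u => //; exists w.
Qed.

Fact cyclic_sub_closed v : submod_closed [in [set (a : R^c) *: v | a in [set: R]]].
Proof.
apply/submod_closedP; split=> [|b _ _ [a1 _ <-] [a2 _ <-]].
  by exists 0 => //; rewrite scale0r.
exists ((b : R^c) * a1 + a2) => //; by rewrite scalerDl scalerA.
Qed.
Definition cyclic_sub v : submod M := Submod (cyclic_sub_closed v).
Lemma cyclic_subP v x : cyclic_sub v x <-> exists a : R^c, x = a *: v.
Proof. by split=> [[a _ <-]|[a ->]]; exists a. Qed.
Lemma cyclic_sub_id v : cyclic_sub v v. Proof. by apply/cyclic_subP; exists 1; rewrite scale1r. Qed.
Lemma cyclic_sub_le v A : A v -> (cyclic_sub v <= A)%O.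
Proof. by move=> Av; apply/submod_leP => x /cyclic_subP[a ->]; apply: submod_scale. Qed.

Definition linform (phi : M -> R^c) :=
  forall a x y, phi (a *: x + y) = a * phi x + phi y.

Section Form.
Variables (phi : M -> R^c).
Hypothesis hphi : linform phi.
Lemma lform0 : phi 0 = 0.
Proof.
have := hphi 1 0 0; rewrite scaler0 addr0 mul1r => /esym /(canRL (addrK _)).
by rewrite subrr.
Qed.
Lemma lformD x y : phi (x + y) = phi x + phi y.
Proof. by rewrite -[x in LHS]scale1r hphi mul1r. Qed.
Lemma lformZ a x : phi (a *: x) = a * phi x.
Proof. by rewrite -[_ *: _]addr0 hphi lform0 addr0. Qed.
Lemma lformN x : phi (- x) = - phi x.
Proof. by rewrite -scaleN1r lformZ mulN1r. Qed.
Lemma lformB x y : phi (x - y) = phi x - phi y.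
Proof. by rewrite lformD lformN. Qed.
Lemma lform_sum (I : Type) (r : seq I) (P : pred I) (F : I -> M) :
  phi (\sum_(i <- r | P i) F i) = \sum_(i <- r | P i) phi (F i).
Proof. exact: (big_morph phi lformD lform0). Qed.
Lemma lform_mulr b : linform (fun x => phi x * b).
Proof. by move=> a x y; rewrite hphi mulrDl mulrA. Qed.
Lemma lform_comp f : linear f -> linform (phi \o f).
Proof. by move=> lf a x y /=; rewrite lf hphi. Qed.
End Form.

Lemma lform_add phi psi : linform phi -> linform psi -> linform (fun x => phi x + psi x).
Proof. by move=> h k a x y; rewrite h k mulrDr addrACA. Qed.

(** A transvection when phi v = 0, a dilatation when phi v <> 0. With an
invertible 1 + phi v it is a linear automorphism; all linear maps used in the
proof are of this kind. Scalars act on the left through the converse ring, so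
products of scalars read in the order opposite to that of R. *)
Definition shear v (phi : M -> R^c) x : M := x + phi x *: v.

Lemma shear_linear v phi : linform phi -> linear (shear v phi).
Proof.
move=> h a x y; rewrite /shear h scalerDl scalerDr -scalerA addrACA //.
Qed.

Definition invertible (y : R^c) := exists w, w * y = 1 /\ y * w = 1.

Lemma shear_comp v phi x w psi : linform phi ->
  shear v phi (shear w psi x) = x + psi x *: w + (phi x + psi x * phi w) *: v.
Proof. by move=> h; rewrite /shear (lformD h) (lformZ h). Qed.

Lemma shearK v phi w : linform phi -> (1 + phi v) * w = 1 ->
  cancel (shear v phi) (shear (- (w *: v)) phi).
Proof.
move=> h hw x; rewrite shear_comp // -addrA scalerN scalerA -scalerBl.
rewrite -{2}[phi x]mulr1 -mulrDr -mulrA hw mulr1 subrr scale0r addr0 //.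
Qed.

Lemma shearVK v phi w : linform phi -> w * (1 + phi v) = 1 ->
  cancel (shear (- (w *: v)) phi) (shear v phi).
Proof.
move=> h hw x; rewrite shear_comp // -addrA scalerN scalerA -scaleNr -scalerDl.
rewrite (lformN h) (lformZ h).
rewrite -{2}[phi x]mulr1 -mulrN -mulrDr -mulrDr addrCA -opprD.
rewrite -{1}[w]mulr1 -mulrDr hw subrr mulr0 scale0r addr0 //.
Qed.

(** A relation rather than a function of f, so that a lattice automorphism
can be compared with f without f carrying a proof of bijectivity. *)
Definition induces (g : latAut (submod M)) f := forall A x, A x <-> (g A) (f x).

Lemma induces_comp g h f k : induces g f -> induces h k -> induces (g * h)%g (f \o k).
Proof. by move=> gf hk A x; rewrite (hk A x) (gf _ (k x)). Qed.

Lemma induces_inv g f f' : induces g f -> cancel f' f -> induces g^-1%g f'.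
Proof. by move=> gf ff' A x; rewrite (gf (g^-1%g A)) aut_KinvE ff'. Qed.

Lemma induces_fix g f f' A : induces g f -> cancel f' f -> (forall x, A x <-> A (f x)) -> g A = A.
Proof.
move=> gf ff' fA; apply: submod_eqP => x.
by rewrite -(ff' x) -gf fA.
Qed.

(** The image of a submodule is encoded as its preimage under the inverse
map, for which closure and the lattice laws are immediate. *)
Lemma induces_exists f f' : linear f -> cancel f f' -> cancel f' f ->
  exists g, induces g f.
Proof.
move=> lf ff' f'f.
have lf' : linear f'.
  by move=> a x y; apply: (can_inj ff'); rewrite lf !f'f.
have cl (h : M -> M) : linear h -> forall A, submod_closed [in [set x | A (h x)]].
  move=> lh A; apply/submod_closedP; split=> /= [|a u v hu hv].
    have -> : h 0 = 0.
      have := lh 1 0 0; rewrite scaler0 addr0 scale1r => /esym /(canRL (addrK _)).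
      by rewrite subrr.
    exact: submod_mem0.
  by rewrite lh; apply: submod_lin.
pose G A := Submod (cl f' lf' A); pose G' A := Submod (cl f lf A).
have GK : cancel G G'.
  by move=> A; apply: submod_eqP => x /=; rewrite ff'.
have G'K : cancel G' G.
  by move=> A; apply: submod_eqP => x /=; rewrite f'f.
have mG : Order.meet_morphism G by move=> A B; apply: submod_eqP.
have hD (h : M -> M) : linear h -> forall x y, h (x + y) = h x + h y.
  by move=> lh x y; rewrite -[x in LHS]scale1r lh scale1r.
have jG : Order.join_morphism G.
  move=> A B; apply: submod_eqP => x; split.
  - move=> [u Au [v Bv euv]]; exists (f u); first by rewrite /G /= ff'.
    by exists (f v); [rewrite /G /= ff'|rewrite -hD // euv f'f].
  - move=> [u Au [v Bv <-]]; exists (f' u) => //; exists (f' v) => //.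
    by rewrite -hD.
by exists (LatAut GK G'K mG jG) => A x /=; rewrite ff'.
Qed.

End Submodules.

(** * Coordinate submodules and linear maps inducing elements of F *)

Section Coordinates.
Variables (R : pzRingType) (M : lmodType R^c) (n : nat) (e : 'I_n -> M).
Hypothesis he : is_basis e.
Implicit Types (A B C : submod M) (x y v : M) (i j k l : 'I_n).

Definition coordinate x i : R^c := sval (cid (he x)) i.

Lemma coordinateE x : x = \sum_i coordinate x i *: e i.
Proof. by rewrite /coordinate; case: cid => c []. Qed.

Lemma coordinate_uniq x (a : 'I_n -> R^c) : x = \sum_i a i *: e i -> coordinate x = a.
Proof. by rewrite /coordinate; case: cid => c [_ cP] /= /cP. Qed.

Lemma coordinate_linform i : linform (coordinate^~ i).
Proof.
move=> a x y; rewrite (coordinate_uniq (a := fun i => a * coordinate x i + coordinate y i)) //.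
rewrite {1}[x]coordinateE {1}[y]coordinateE scaler_sumr -big_split /=.
by apply: eq_bigr => l _; rewrite scalerA scalerDl.
Qed.

Lemma coordinate_basis i j : coordinate (e i) j = (i == j)%:R.
Proof.
rewrite (coordinate_uniq (a := fun j => (i == j)%:R)) // (bigD1 i) //= eqxx scale1r.
by rewrite big1 ?addr0 // => l; rewrite eq_sym => /negPf->; rewrite scale0r.
Qed.

Lemma coordinate_self i : coordinate (e i) i = 1. Proof. by rewrite coordinate_basis eqxx. Qed.
Lemma coordinate_other i j : i != j -> coordinate (e i) j = 0.
Proof. by rewrite coordinate_basis => /negPf->. Qed.

Lemma coordinateD x y i : coordinate (x + y) i = coordinate x i + coordinate y i.
Proof. exact: (lformD (coordinate_linform i)). Qed.
Lemma coordinateZ a x i : coordinate (a *: x) i = a * coordinate x i.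
Proof. exact: (lformZ (coordinate_linform i)). Qed.

Lemma coordinate_eq0 x : (forall i, coordinate x i = 0) -> x = 0.
Proof. by move=> x0; rewrite [x]coordinateE big1 // => i _; rewrite x0 scale0r. Qed.

Fact coord_submod_closed (P : pred 'I_n) :
  submod_closed [in [set x | forall i, ~~ P i -> coordinate x i = 0]].
Proof.
apply/submod_closedP; split=> /= [i _|a u v hu hv i Pi].
  exact: (lform0 (coordinate_linform i)).
by rewrite (coordinate_linform i) hu // hv // mulr0 addr0.
Qed.
Definition coord_submod P : submod M := Submod (coord_submod_closed P).

Lemma coord_submodP (P : pred 'I_n) x : coord_submod P x <-> forall i, ~~ P i -> coordinate x i = 0.
Proof. by []. Qed.

Lemma coord_submod_basis (P : pred 'I_n) i : P i -> coord_submod P (e i).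
Proof. by move=> Pi; apply/coord_submodP => j Pj; apply: coordinate_other;
  apply: contraNneq Pj => <-. Qed.

Lemma coord_submod_le (P : pred 'I_n) A : (forall i, P i -> A (e i)) -> (coord_submod P <= A)%O.
Proof.
move=> PA; apply/submod_leP => x /coord_submodP xP; rewrite [x]coordinateE;
  apply: submod_sum => i _.
have [Pi|Pi] := boolP (P i); first by apply: submod_scale; apply: PA.
by rewrite xP // scale0r; apply: submod_mem0.
Qed.

Lemma coord_submod_mono (P Q : pred 'I_n) : subpred P Q -> (coord_submod P <= coord_submod Q)%O.
Proof. by move=> PQ; apply: coord_submod_le => i /PQ; apply: coord_submod_basis. Qed.

Lemma eq_coord_submod (P Q : pred 'I_n) : P =1 Q -> coord_submod P = coord_submod Q.
Proof. by move=> /funext->. Qed.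

Definition axis k := coord_submod (pred1 k).
Definition coaxis k := coord_submod (predC1 k).

Lemma axisP k x : axis k x <-> x = coordinate x k *: e k.
Proof.
split=> [/coord_submodP xk|->]; last by apply/submod_scale/coord_submod_basis/eqxx.
rewrite {1}[x]coordinateE (bigD1 k) //= big1 ?addr0 // => i ik.
by rewrite xk ?scale0r.
Qed.
Lemma axisZ k a : axis k (a *: e k).
Proof. by apply/submod_scale/coord_submod_basis/eqxx. Qed.
Lemma axis_basis k : axis k (e k).
Proof. by apply/coord_submod_basis/eqxx. Qed.
Arguments axis_basis : clear implicits.

Lemma coaxisP k x : coaxis k x <-> coordinate x k = 0.
Proof.
split=> [/coord_submodP|xk]; first by apply; rewrite /= negbK.
by apply/coord_submodP => i; rewrite negbK => /eqP->.
Qed.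

Lemma axis_smul k : smul (e k) (idealT R) = axis k.
Proof.
apply: submod_eqP => x; split; first by move=> [a _ <-]; apply: axisZ.
by move=> /axisP->; exists (coordinate x k).
Qed.

Lemma axis_meet k : (axis k `&` coaxis k)%O = \bot%O.
Proof.
apply: submod_eqP => x; split=> [[/axisP-> /coaxisP]|->]; last by split; apply: submod_mem0.
by rewrite coordinateZ coordinate_self mulr1 => ->; rewrite scale0r.
Qed.

Lemma axis_join k x : (axis k `|` coaxis k)%O x.
Proof.
apply/submod_joinP; exists (coordinate x k *: e k), (x - coordinate x k *: e k); split.
- exact: axisZ.
- by apply/coaxisP; rewrite (lformB (coordinate_linform k)) coordinateZ coordinate_self mulr1 subrr.
- by rewrite addrC subrK.
Qed.

Lemma axis_le_coaxis k l : k != l -> (axis k <= coaxis l)%O.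
Proof. by move=> kl; apply: coord_submod_mono => i /eqP->. Qed.

Lemma pstab_L0E g : pstab (L0 e) g <-> forall k, g (axis k) = axis k.
Proof.
split=> [gs k|gk]; first by apply: gs; apply: sub_gen; exists k => //; rewrite axis_smul.
by apply: pstab_gen => _ [k _ <-]; rewrite axis_smul.
Qed.

Lemma coord_submod_joinE (P : pred 'I_n) : coord_submod P = (\join_(i | P i) axis i)%O.
Proof.
apply/le_anti/andP; split.
  apply: coord_submod_le => i Pi; apply/submod_leP: (e i) (axis_basis i).
  exact: joins_sup.
by apply/joinsP => i Pi; apply: coord_submod_mono => j /eqP->.
Qed.

Section Group.
Variables (F : set (latAut (submod M))).
Hypothesis hF : subgroup F.
Hypothesis hHF : pstab (L0 e) `<=` F.

Definition linear_in (f : M -> M) := exists2 g, F g & induces g f.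

Lemma linear_in_comp f h : linear_in f -> linear_in h -> linear_in (f \o h).
Proof.
move=> [g Fg gf] [k Fk kh]; exists (g * k)%g; first exact: subgroupM.
exact: induces_comp.
Qed.

Lemma linear_in_inv f f' : cancel f' f -> linear_in f -> linear_in f'.
Proof.
move=> ff' [g Fg gf]; exists g^-1%g; first exact: subgroupV.
exact: induces_inv ff'.
Qed.

(** A submodule is stable if it contains the direction v, and it is fixed
pointwise if phi vanishes on it. These two cases cover every submodule whose
image has to be known. *)
Lemma shear_aut v phi : linform phi -> invertible (1 + phi v) ->
  exists2 g, induces g (shear v phi) & forall A, A v \/ (forall x, A x -> phi x = 0) -> g A = A.
Proof.
move=> h [w [w1 w2]].
have [g gi] := induces_exists (shear_linear v h) (shearK h w2) (shearVK h w1).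
exists g => // A hA; apply: (induces_fix gi (shearVK h w1)) => x.
have tA u : A u \/ (forall x, A x -> phi x = 0) -> A x -> A (shear u phi x).
  move=> [Au|A0] Ax; last by rewrite /shear A0 // scale0r addr0.
  by apply: submod_add => //; apply: submod_scale.
split; first exact: tA.
move=> Atx; rewrite -[x](shearK h w2).
case: hA => [Av|A0]; first by apply: submod_add => //; apply/submod_scale/submod_opp/submod_scale.
by rewrite {1}/shear (A0 _ Atx) scale0r addr0.
Qed.

(** The conjugate by g0 of such a map fixes every axis, because each
g0 (axis l) with l <> k lies in g0 (coaxis k), where phi vanishes. Hence F
contains, for each of its elements g0, all the dilatations and transvections
with centre in g0 (axis k) and hyperplane containing g0 (coaxis k), and no
semilinear description of g0 is needed. *)
Lemma linear_in_moved_shear g0 k v phi : F g0 -> linform phi -> invertible (1 + phi v) ->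
  (g0 (axis k)) v -> (forall x, (g0 (coaxis k)) x -> phi x = 0) ->
  linear_in (shear v phi).
Proof.
move=> Fg0 h u gv gphi; have [g gi gA] := shear_aut h u.
exists g => //.
have Fc : F (g0^-1 * (g * g0))%g.
  apply/hHF/pstab_L0E => l; rewrite !aut_mulE gA ?aut_invKE //.
  have [->|kl] := eqVneq l k; [by left|right=> x xl].
  apply: gphi; move: x xl; apply/submod_leP; rewrite aut_leE.
  exact: axis_le_coaxis.
have -> : g = (g0 * (g0^-1 * (g * g0)) * g0^-1)%g.
  by apply: latAut_ext => A; rewrite !aut_mulE !aut_KinvE.
by apply: subgroupM => //; [apply: subgroupM|apply: subgroupV].
Qed.

Lemma linear_in_diag k p q : linform q -> invertible (1 + q p) -> axis k p ->
  (forall x, coaxis k x -> q x = 0) -> linear_in (shear p q).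
Proof.
move=> h u kp kq; apply: (linear_in_moved_shear (g0 := 1%g) (k := k)) => //.
exact: subgroup1.
Qed.

Lemma shear_conj (f f' : M -> M) v phi : linear f -> cancel f' f ->
  shear (f v) (phi \o f') = f \o shear v phi \o f'.
Proof.
by move=> lf ff'; apply/funext => x; rewrite /shear /= [in RHS]addrC lf ff' addrC.
Qed.

Lemma linear_in_conj (f f' : M -> M) v phi : linear f -> cancel f f' -> cancel f' f ->
  linear_in f -> linear_in (shear v phi) -> linear_in (shear (f v) (phi \o f')).
Proof.
move=> lf ff' f'f LFf LFt; rewrite shear_conj //.
by apply: linear_in_comp; [apply: linear_in_comp|apply: linear_in_inv LFf].
Qed.

Definition elementary i j (a : R^c) := shear (e i) (fun x => coordinate x j * a).

Lemma elementary_comp i j a b : i != j ->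
  elementary i j a \o elementary i j b = elementary i j (a + b).
Proof.
move=> ij; apply/funext => x; rewrite /= /elementary shear_comp;
  last exact: (lform_mulr (coordinate_linform _)).
by rewrite coordinate_other // mul0r mulr0 addr0 -addrA -scalerDl -mulrDr [b + a]addrC.
Qed.

End Group.
End Coordinates.

Arguments axisZ [R M n e] he k a.
Arguments axis_basis [R M n e] he k.
Arguments coordinate_eq0 [R M n e] he x.

(** * Simple Artinian rings seen through a primitive idempotent *)

(** Six is the largest number of scalars that has to be avoided at once when
the base ring is a skew field. A skew field with at most six elements is a
field with 2, 3, 4 or 5 elements. *)
Definition more_than_six (T : eqType) := forall s : seq T,
  (size s <= 6)%N -> exists x, x \notin s.

Section Ring.
Variables (S : pzRingType) (eps : S).

(** What the proof uses of a full matrix ring over a skew field: eps is a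
primitive idempotent, eps S eps is a division ring, the ideal S eps S is S, and
the units generate S as a ring. The elements v of a module with eps v = v play
the part of vectors over that division ring, and the forms phi with
phi x eps = phi x that of covectors; then phi v lies in eps S eps. *)
Record simple_artinian : Prop := SimpleArtinian {
  eps_idem : eps * eps = eps;
  eps_neq0 : eps != 0;
  eps_div : forall x, eps * x * eps != 0 ->
    exists y, (eps * y * eps) * (eps * x * eps) = eps /\
              (eps * x * eps) * (eps * y * eps) = eps;
  eps_span : exists k (p q : 'I_k -> S), 1 = \sum_a p a * eps * q a;
  unit_span : forall P : S -> Prop,
    (forall u, (exists w, w * u = 1 /\ u * w = 1) -> P u) ->
    (forall x y, P x -> P y -> P (x - y)) ->
    (forall x y, P x -> P y -> P (x * y)) -> forall x, P x }.

(** Among the rings considered this fails only for the field with two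
elements. *)
Definition two_vectors := exists l1 l2 : S,
  [/\ l1 != l2, l1 != 0, l2 != 0, eps * l1 = l1 & eps * l2 = l2].

(** A vector is annihilated by two distinct nonzero covectors: true for
matrices of size at least three, and for size two once the skew field has a
scalar other than 0 and 1. This excludes M(2, F_2). *)
Definition two_covectors := forall c : S, eps * c = c -> exists m1 m2 : S,
  [/\ m1 != m2, m1 != 0, m2 != 0, m1 * eps = m1 & m2 * eps = m2] /\
  c * m1 = 0 /\ c * m2 = 0.

Hypothesis hS : simple_artinian.
Let epsK := eps_idem hS.

Definition corner x := eps * x = x /\ x * eps = x.

Lemma corner_inv x : corner x -> x != 0 ->
  exists y, [/\ corner y, y * x = eps & x * y = eps].
Proof.
move=> [ex xe] x0; have /(eps_div hS) : eps * x * eps != 0 by rewrite ex xe.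
rewrite ex xe => -[y [yx xy]]; exists (eps * y * eps); split => //.
by split; [rewrite !mulrA epsK|rewrite -!mulrA epsK].
Qed.

Lemma corner_mull_neq0 x : x != 0 -> exists a, eps * a * x != 0.
Proof.
move=> x0; apply: contra_notP (negP x0) => nx; apply/eqP.
have [k [p [q E]]] := eps_span hS; rewrite -[x]mul1r E mulr_suml big1 // => a _.
rewrite -!mulrA; have [->|h] := eqVneq (eps * (q a * x)) 0; first by rewrite mulr0.
by case: nx; exists (q a); rewrite -mulrA.
Qed.

Lemma corner_mulr_neq0 x : x != 0 -> exists b, x * b * eps != 0.
Proof.
move=> x0; apply: contra_notP (negP x0) => nx; apply/eqP.
have [k [p [q E]]] := eps_span hS; rewrite -[x]mulr1 E mulr_sumr big1 // => a _.
rewrite !mulrA; have [->|h] := eqVneq (x * p a * eps) 0; first by rewrite mul0r.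
by case: nx; exists (p a).
Qed.

Lemma left_eps x : x * eps = x -> x != 0 -> exists2 a, eps * a = a & a * x = eps.
Proof.
move=> xe /corner_mull_neq0[a ax].
have cx : corner (eps * a * x) by split; [rewrite !mulrA epsK|rewrite -!mulrA xe].
have [y [[ey ye] yx _]] := corner_inv cx ax.
by exists (y * (eps * a)); rewrite ?[eps * (y * _)]mulrA ?ey // -mulrA.
Qed.

Lemma right_eps x : eps * x = x -> x != 0 -> exists2 b, b * eps = b & x * b = eps.
Proof.
move=> ex /corner_mulr_neq0[b xb].
have cx : corner (x * b * eps) by split; [rewrite !mulrA ex|rewrite -!mulrA epsK].
have [y [[ey ye] _ xy]] := corner_inv cx xb.
by exists (b * eps * y); [rewrite -mulrA ye|rewrite !mulrA].
Qed.

(** The inverse acts as 1 on the complementary idempotent 1 - eps and as the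
inverse of eps + y in the division ring eps S eps. *)
Lemma corner_unit y : corner y -> y != - eps ->
  exists w, [/\ w * (1 + y) = 1, (1 + y) * w = 1 & w * eps = eps * w].
Proof.
move=> [ey ye] yne.
have cy : corner (eps + y) by split; rewrite ?mulrDr ?mulrDl epsK ?ey ?ye.
have y0 : eps + y != 0 by rewrite addrC addr_eq0.
have [z [[ez ze] zy yz]] := corner_inv cy y0.
exists (1 - eps + z); split.
- have -> : 1 + y = 1 - eps + (eps + y) by rewrite addrA subrK.
  rewrite mulrDl mulrDr [X in _ + X]mulrDr zy mulrBl mul1r mulrBr mulr1 epsK subrr subr0.
  rewrite mulrBl mul1r [eps * (_ + _)](proj1 cy) subrr addr0 mulrBr mulr1 ze subrr add0r subrK //.
- have -> : 1 + y = 1 - eps + (eps + y) by rewrite addrA subrK.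
  rewrite mulrDl mulrDr [X in _ + X]mulrDr yz mulrBl mul1r mulrBr mulr1 epsK subrr subr0.
  rewrite mulrBl mul1r ez subrr addr0 mulrBr mulr1 (proj2 cy) subrr add0r subrK //.
- by rewrite mulrDl mulrDr mulrBl mulrBr mul1r mulr1 epsK ez ze.
Qed.

Lemma eps_mul_neq0 x z y : x * eps = x -> corner z -> eps * y = y ->
  x != 0 -> z != 0 -> y != 0 -> x * z * y != 0.
Proof.
move=> xe cz ey x0 z0 y0; apply/eqP => E.
have [a _ ax] := left_eps xe x0.
have [b _ yb] := right_eps ey y0.
have : a * (x * z * y) * b = 0 by rewrite E mulr0 mul0r.
rewrite !mulrA ax (proj1 cz) -mulrA yb (proj2 cz) => /eqP; exact/negP.
Qed.

(** A nonzero ideal meets the corner eps S eps in a nonzero, hence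
invertible, element; so it contains eps, and then S eps S = S. *)
Lemma simple_ideal (I : S -> Prop) :
  (forall x y, I x -> I y -> I (x + y)) -> (forall x a, I x -> I (a * x) /\ I (x * a)) ->
  (exists2 x, I x & x != 0) -> forall x, I x.
Proof.
move=> ID IM [x Ix x0] y.
have [a ax] := corner_mull_neq0 x0; have [b xb] := corner_mulr_neq0 ax.
have Ieps : I eps.
  have E : eps * a * x * b * eps = eps * (a * x * b) * eps by rewrite !mulrA.
  have [|z [zx _]] := @eps_div hS (a * x * b); first by rewrite -E.
  have IMl u v : I v -> I (u * v) by move=> /(IM _ u)[].
  have IMr u v : I v -> I (v * u) by move=> /(IM _ u)[].
  by rewrite -zx -E; apply/IMl/IMr/IMr/IMl.
rewrite -[y]mulr1; apply: (proj1 (IM _ y _)).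
have [k [p [q ->]]] := eps_span hS.
have I0 : I 0 by rewrite -(mul0r eps); apply: (proj1 (IM _ 0 _)).
elim/big_ind: _ => // c _; apply: (proj2 (IM _ _ _)); exact: (proj1 (IM _ _ _)).
Qed.

End Ring.

(** * Chain conditions in the lattice of submodules *)

Section Rank.
Variables (R : pzRingType) (eps : R^c) (hS : simple_artinian eps).
Variables (M : lmodType R^c) (n : nat) (e : 'I_n -> M) (he : is_basis e).
Implicit Types (A B C : submod M) (x y v : M) (i j k l : 'I_n).

(** Passing from U to U + S v adds to the rank of A the answer to the
question whether A lies in U. Strictness holds because S v is a minimal
submodule modulo U: if A and B meet U in the same submodule and neither lies in
U, a multiple of an element of A corrects any element of B into U. *)
Lemma rank_step v U : eps *: v = v ->
  (exists d : submod M -> nat, forall A B, (B <= U)%O -> (A < B)%O -> (d A < d B)%N) ->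
  exists d : submod M -> nat,
    forall A B, (B <= U `|` cyclic_sub v)%O -> (A < B)%O -> (d A < d B)%N.
Proof.
move=> ev [d dU].
exists (fun A => d (A `&` U)%O + ~~ (A <= U)%O)%N => A B BUv AB.
have AUBU : (A `&` U <= B `&` U)%O by apply: leI2 => //; apply: ltW.
have dle : (d (A `&` U)%O <= d (B `&` U)%O)%N.
  move: AUBU; rewrite le_eqVlt => /predU1P[->//|lt].
  by apply: ltnW; apply: dU => //; apply: leIr.
have ble : (~~ (A <= U)%O <= ~~ (B <= U)%O)%N.
  case: (boolP (B <= U)%O) => [BU|_]; last by rewrite leq_b1.
  by rewrite (le_trans (ltW AB) BU).
move: AUBU; rewrite le_eqVlt => /predU1P[eAB|lt]; last first.
  rewrite -addSn; apply: leq_add => //; apply: dU => //; apply: leIr.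
rewrite eAB ltn_add2l.
have nBU : ~~ (B <= U)%O.
  apply/negP => BU; move: (AB); rewrite lt_neqAle => /andP[/eqP nAB _]; apply: nAB.
  by rewrite -(meet_l BU) -eAB; apply/esym/meet_l/(le_trans (ltW AB)).
case: (boolP (A <= U)%O) => [|nAU]; first by rewrite nBU.
exfalso; move: (AB); rewrite lt_neqAle => /andP[/eqP nAB /submod_leP lAB]; apply: nAB.
apply/le_anti; rewrite (ltW AB) /=; apply/submod_leP => b Bb.
have [a Aa nUa] : exists2 a, A a & ~ U a.
  apply: contrapT => h; move/negP: nAU; apply; apply/submod_leP => a Aa.
  by apply: contrapT => Ua; apply: h; exists a.
have /submod_leP BUv' := BUv.
have /BUv'[u Uu [_ /cyclic_subP[r ->] ea]] := lAB _ Aa.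
have /BUv'[u' Uu' [_ /cyclic_subP[r' ->] eb]] := Bb.
have re0 : r * eps != 0.
  apply/eqP => re; apply: nUa; rewrite -ea -ev scalerA re scale0r addr0 //.
have [s _ sr] : exists2 s, eps * s = s & s * (r * eps) = eps.
  by apply: (left_eps hS) => //; rewrite -mulrA (eps_idem hS).
have Uba : U (b - (r' * s) *: a).
  rewrite -ea -eb scalerDr scalerA opprD addrACA -scalerBl.
  have -> : (r' - r' * s * r) *: v = 0.
    by rewrite -{1}ev scalerA mulrBl -!mulrA sr subrr scale0r.
  by rewrite addr0; apply: submod_sub => //; apply: submod_scale.
have [] : (A `&` U)%O (b - (r' * s) *: a).
  by rewrite eAB; split => //; apply: submod_sub => //; apply/submod_scale/lAB.
by move=> Aba _; rewrite -[b](subrK ((r' * s) *: a)); apply: submod_add => //; apply: submod_scale.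
Qed.

(** Chains of submodules are bounded because M is spanned by finitely many
vectors. A strictly monotone function into nat is all that is needed; its
modularity is replaced by the fixed point arguments below. *)
Lemma submod_rank : exists d : submod M -> nat, forall A B, (A < B)%O -> (d A < d B)%N.
Proof.
have [k [p [q E]]] := eps_span hS.
have span r : (forall v, v \in r -> eps *: v = v) ->
  exists d : submod M -> nat, forall A B, (B <= \join_(v <- r) cyclic_sub v)%O -> (A < B)%O ->
    (d A < d B)%N.
  elim: r => [_|v r IH hr].
    exists (fun=> 0%N) => A B; rewrite big_nil lex0 => /eqP->.
    by rewrite lt_neqAle lex0; case: eqP.
  rewrite big_cons joinC; apply: rank_step; first by apply: hr; rewrite mem_head.
  by apply: IH => w wr; apply: hr; rewrite inE wr orbT.
pose r := [seq (eps * q a) *: e i | i <- enum 'I_n, a <- enum 'I_k].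
have [|d dr] := span r.
  by move=> _ /allpairsP[[i a] [_ _ ->]] /=; rewrite scalerA mulrA (eps_idem hS).
exists d => A B; apply: dr.
have hr i a : (\join_(v <- r) cyclic_sub v)%O ((eps * q a) *: e i).
  apply: submod_le_mem (cyclic_sub_id _); apply: joins_sup_seq => //.
  by apply/allpairsP; exists (i, a); rewrite !mem_enum.
apply/submod_leP => x _; rewrite [x](coordinateE he); apply: submod_sum => i _.
rewrite -[coordinate he x i]mulr1 E mulr_sumr scaler_suml; apply: submod_sum => a _.
have -> : coordinate he x i * (p a * eps * q a) = (coordinate he x i * p a) * (eps * q a)
  by rewrite !mulrA.
by rewrite -scalerA; apply/submod_scale/hr.
Qed.

(** Otherwise the iterates of the top would form an infinite descending
chain. *)
Lemma strict_fix (f : submod M -> submod M) T :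
  (forall A B, (B <= T)%O -> (A < B)%O -> (f A < f B)%O) ->
  (f T <= T)%O -> f T = T.
Proof.
have [d dP] := submod_rank.
move=> fm fT; apply/eqP; apply: contraT => nfT.
have lt : (f T < T)%O by rewrite lt_neqAle nfT.
pose I (k : nat) := iter k f T.
have I1 (k : nat) : (I k.+1 < I k)%O /\ (I k <= T)%O.
  elim: k => [//|k [lk kT]]; split; first exact: fm.
  exact: le_trans (ltW lk) kT.
have I2 (k : nat) : (d (I k) + k <= d T)%N.
  elim: k => [|k IH]; first by rewrite addn0.
  rewrite addnS -addSn; apply: leq_trans IH; rewrite leq_add2r.
  by apply: dP; case: (I1 k).
by have := leq_trans (leq_addl _ _) (I2 (d T).+1); rewrite ltnn.
Qed.

(** Otherwise the iterates of the bottom would form an infinite ascending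
chain inside T. *)
Lemma strict_fix0 (f : submod M -> submod M) T :
  (forall A B, (B <= T)%O -> (A < B)%O -> (f A < f B)%O) ->
  (forall A, (A <= T)%O -> (f A <= T)%O) -> f \bot%O = \bot%O.
Proof.
have [d dP] := submod_rank.
move=> fm fT; apply/eqP; apply: contraT => nf0.
have lt : (\bot%O < f \bot%O)%O by rewrite lt0x.
pose I (k : nat) := iter k f \bot%O.
have IT (k : nat) : (I k <= T)%O by elim: k => [|k IH]; [exact: le0x|exact: fT].
have I1 (k : nat) : (I k < I k.+1)%O by elim: k => //= k lk; apply: fm => //; apply: (IT k.+1).
have I2 (k : nat) : (k <= d (I k))%N.
  by elim: k => // k IH; apply: leq_ltn_trans IH _; apply: dP.
have dm A B : (A <= B)%O -> (d A <= d B)%N.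
  by rewrite le_eqVlt => /predU1P[->//|/dP/ltnW].
by have := leq_trans (I2 _) (dm _ _ (IT (d T).+1)); rewrite ltnn.
Qed.

End Rank.

(** * Moved axes and complements of coordinate hyperplanes *)

Section Perspectivity.
Variables (R : pzRingType) (eps : R^c) (hS : simple_artinian eps).
Variables (M : lmodType R^c) (n : nat) (e : 'I_n -> M) (he : is_basis e).
Implicit Types (A B C : submod M) (x y v : M) (i j k l : 'I_n).

Local Notation axis := (axis he).
Local Notation coaxis := (coaxis he).
Local Notation coordinate := (coordinate he).

Lemma eq_joinl A B P : (A <= B)%O -> (B `&` P = \bot)%O -> (A `|` P = B `|` P)%O -> A = B.
Proof.
move=> AB BP E; have := submod_modular P AB.
by rewrite E meetC joinKI meetC BP joinx0.
Qed.

Lemma eq_meetr A B P Q : (P <= A)%O -> (P <= B)%O -> (forall x, (P `|` Q)%O x) ->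
  (A `&` Q = B `&` Q)%O -> A = B.
Proof.
move=> PA PB top; have h C : (P <= C)%O -> C = (P `|` (C `&` Q))%O.
  by move=> PC; rewrite [X in (P `|` X)%O]meetC -submod_modular // meetC;
    apply/esym/meet_l/submod_leP.
by move=> E; rewrite (h A) // (h B) // E.
Qed.

Lemma coaxis_join k x : (coaxis k `|` axis k)%O x.
Proof. by rewrite joinC; apply: axis_join. Qed.

(** An injective map between spaces of equal finite dimension is
surjective. The dimensions agree because g carries the axis to its image; this
is exploited by composing g with the projection back to the axis and applying
strict_fix. *)
Lemma meet0_join (g : latAut (submod M)) k :
  (g (axis k) `&` coaxis k = \bot)%O -> forall x, (g (axis k) `|` coaxis k)%O x.
Proof.
move=> N0.
pose f A := ((g A `|` coaxis k) `&` axis k)%O.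
have fT : (f (axis k) <= axis k)%O by apply: leIr.
have : f (axis k) = axis k.
  apply: (strict_fix hS he) => // A B BT AB; rewrite lt_neqAle.
  have gAB : (g A <= g B)%O by rewrite aut_leE ltW.
  apply/andP; split; last by apply: leI2 => //; apply: leU2.
  apply/eqP => /(eq_meetr (leUr _ _) (leUr _ _) (@coaxis_join k)) E.
  move: AB; rewrite lt_neqAle => /andP[/eqP nAB _]; apply: nAB.
  apply: (can_inj (aut_funK g)); apply: (eq_joinl gAB _ E).
  by apply/le_anti; rewrite le0x andbT -N0; apply: leI2 => //; rewrite aut_leE.
move=> E x; have : (axis k `|` coaxis k <= g (axis k) `|` coaxis k)%O.
  by rewrite leUx leUr andbT -[X in (X <= _)%O]E leIl.
by move=> /submod_le_mem; apply; apply: axis_join.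
Qed.

(** The converse, surjective implies injective, by the inverse
composition. *)
Lemma join_meet0 (g : latAut (submod M)) k :
  (forall x, (g (axis k) `|` coaxis k)%O x) -> (g (axis k) `&` coaxis k = \bot)%O.
Proof.
move=> top.
pose f A := g^-1%g ((A `|` coaxis k) `&` g (axis k))%O.
have : f \bot%O = \bot%O.
  apply: (strict_fix0 hS he (T := axis k)) => [A B BT AB|A AT]; last first.
    by rewrite /f -[X in (_ <= X)%O](aut_invKE g) aut_leE leIr.
  have lAB := ltW AB.
  rewrite lt_neqAle /f aut_leE; apply/andP; split; last by apply: leI2 => //; apply: leU2.
  apply/eqP => /(can_inj (aut_funK _))/eq_meetr E.
  move: AB; rewrite lt_neqAle => /andP[/eqP nAB _]; apply: nAB.
  apply: (eq_joinl (P := coaxis k) lAB).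
    by apply/le_anti; rewrite le0x andbT -(axis_meet he k); apply: leI2.
  by apply: (E (coaxis k)); rewrite ?leUr // => x; rewrite joinC.
rewrite /f join0x => /(congr1 g); rewrite aut_KinvE aut_bot => <-; exact: meetC.
Qed.

End Perspectivity.

(** * Gaussian elimination along a preorder *)

Section Elimination.
Variables (R : pzRingType) (eps : R^c) (hS : simple_artinian eps).
Variables (M : lmodType R^c) (n : nat) (e : 'I_n -> M) (he : is_basis e).
Variables (F : set (latAut (submod M))).
Hypothesis hF : subgroup F.
Hypothesis hHF : pstab (L0 e) `<=` F.
Variable r : rel 'I_n.
Hypotheses (rxx : reflexive r) (rtr : transitive r).
Hypothesis rF : forall i j, r i j -> i != j -> forall a, linear_in F (elementary he i j a).
Implicit Types (A B C : submod M) (x y v : M) (i j k l : 'I_n).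
Implicit Types (g u : latAut (submod M)).

Local Notation axis := (axis he).
Local Notation coaxis := (coaxis he).
Local Notation coordinate := (coordinate he).

(** For a preorder these are the generators of the lattice of its net. *)
Definition down s := coord_submod he (r^~ s).
Definition fixdown g := forall s, g (down s) = down s.

Lemma fixdownM g u : fixdown g -> fixdown u -> fixdown (g * u)%g.
Proof. by move=> hg hu s; rewrite aut_mulE hu hg. Qed.

Lemma linear_in_shear_aut v phi : linform phi -> invertible (1 + phi v) ->
  linear_in F (shear v phi) ->
  exists g, [/\ F g, induces g (shear v phi) &
    forall A, A v \/ (forall x, A x -> phi x = 0) -> g A = A].
Proof.
move=> h u [g Fg gi]; exists g; split => //.
have [g' g'i g'A] := shear_aut h u.
have [w [w1 w2]] := u.
suff -> : g = g' by [].
apply: latAut_ext => A; apply: submod_eqP => x.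
by rewrite -(shearVK h w1 x) -gi -g'i.
Qed.

Lemma invertible1 : invertible (1 : R^c). Proof. by exists 1; rewrite mulr1. Qed.

Lemma down_fix v k : down k v -> forall s, down s v \/ (forall x, down s x -> coordinate x k = 0).
Proof.
move=> kv s; case: (boolP (r k s)) => rks.
  by left; apply: submod_le_mem kv; apply: coord_submod_mono => i rik; apply: rtr rks.
by right => x /coord_submodP; apply.
Qed.

Lemma linear_in_column k (s : seq 'I_n) (a : 'I_n -> R^c) : all (predC1 k) s ->
  (forall l, l \in s -> r l k \/ a l = 0) ->
  linear_in F (shear (\sum_(l <- s) a l *: e l) (coordinate^~ k)).
Proof.
elim: s => [_ _|l s IH /= /andP[lk sk] h].
  have -> : shear (\sum_(l <- [::]) a l *: e l) (coordinate^~ k) = id.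
    by apply/funext => x; rewrite big_nil /shear scaler0 addr0.
  by exists 1%g => //; apply: subgroup1.
have h0 : coordinate (\sum_(l <- s) a l *: e l) k = 0.
  rewrite (lform_sum (coordinate_linform he k)) big_seq big1 // => i si; rewrite coordinateZ.
  by rewrite coordinate_other ?mulr0 //; apply: (allP sk).
(* The partial sums have zero k-th coordinate, so the factors compose additively. *)
have {}IH : linear_in F (shear (\sum_(l <- s) a l *: e l) (coordinate^~ k)).
  by apply: IH => // i si; apply: h; rewrite inE si orbT.
rewrite big_cons.
have [rlk|->] := h l (mem_head _ _); last by rewrite scale0r add0r.
have -> : shear (a l *: e l + \sum_(l <- s) a l *: e l) (coordinate^~ k) =
   elementary he l k (a l) \o shear (\sum_(l <- s) a l *: e l) (coordinate^~ k).
  apply/funext => x; rewrite /= /elementary shear_comp;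
    last exact: (lform_mulr (coordinate_linform _ _)).
  by rewrite h0 mul0r mulr0 addr0 /shear scalerDr scalerA -addrA; congr (_ + _); rewrite addrC.
by apply: linear_in_comp => //; apply: rF.
Qed.

(** When g (axis k) is a complement of coaxis k, it is generated by a single
vector m with k-th coordinate 1. As m lies below k, the map fixing the other
basis vectors and sending m to e_k is a product of elementary transvections
along the preorder. *)
Lemma graph_step g (P : pred 'I_n) k : fixdown g -> ~~ P k ->
  (g (axis k) `&` coaxis k = \bot)%O ->
  exists u, [/\ F u, fixdown u, (forall b, P b -> u (axis b) = axis b) & u (g (axis k)) = axis k].
Proof.
move=> gd Pk N0.
have /submod_joinP[m [z [Nm /coaxisP zk em]]] := meet0_join hS N0 (e k).
have mk : coordinate m k = 1.
  by have := congr1 (coordinate^~ k) em; rewrite /= coordinateD zk addr0 coordinate_self.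
have Nle : (g (axis k) <= down k)%O.
  by rewrite -gd aut_leE; apply: coord_submod_mono => i /eqP->; apply: rxx.
have dm : down k m by apply: submod_le_mem Nm.
have dv : down k (e k - m) by apply: submod_sub => //; apply: coord_submod_basis; apply: rxx.
have vk : coordinate (e k - m) k = 0
  by rewrite (lformB (coordinate_linform he k)) coordinate_self mk subrr.
have un : invertible (1 + coordinate (e k - m) k) by rewrite vk addr0; apply: invertible1.
have NE x : g (axis k) x -> x = coordinate x k *: m.
  move=> Nx; apply/eqP; rewrite -subr_eq0; apply/eqP.
  have : (g (axis k) `&` coaxis k)%O (x - coordinate x k *: m).
    split; first by apply: submod_sub => //; apply: submod_scale.
    by apply/coaxisP; rewrite (lformB (coordinate_linform he k)) coordinateZ mk mulr1 subrr.
  by rewrite N0.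
have hm : shear (e k - m) (coordinate^~ k) m = e k by rewrite /shear mk scale1r addrC subrK.
have LFh : linear_in F (shear (e k - m) (coordinate^~ k)).
  have -> : e k - m = \sum_(l <- [seq l <- enum 'I_n | l != k]) coordinate (e k - m) l *: e l.
    rewrite big_filter big_enum_cond /= {1}[e k - m](coordinateE he) (bigD1 k) //= vk scale0r add0r //.
  apply: linear_in_column => [|l _]; first by apply: filter_all.
  by case: (boolP (r l k)) => [|rlk]; [left|right; move/coord_submodP: dv; apply].
have [u [Fu ui uA]] := linear_in_shear_aut (coordinate_linform he k) un LFh.
exists u; split => //.
- by move=> s; apply: uA; apply: down_fix.
- move=> b Pb; apply: uA; right => x /axisP->; rewrite coordinateZ coordinate_other ?mulr0 //.
  by apply: contraNneq Pk => <-.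
have [w [w1 w2]] := un.
have hZ a : shear (e k - m) (coordinate^~ k) (a *: m) = a *: e k.
  by rewrite -{2}hm /shear coordinateZ -scalerA -scalerDr.
apply: submod_eqP => y; rewrite -(shearVK (coordinate_linform he k) w1 y) -ui.
set x := shear _ _ y; split => [/NE ->|/axisP]; first by rewrite hZ; apply: axisZ.
rewrite -hZ => /(can_inj (shearK (coordinate_linform he k) w2)) ->.
by apply: submod_scale.
Qed.

(** The sum of the generators strictly below k and of the axes already
treated in the class of k is a join of submodules fixed by g. *)
Lemma below_fix g (P : pred 'I_n) k : fixdown g -> (forall b, P b -> g (axis b) = axis b) ->
  g (coord_submod he (fun j => r j k && (~~ r k j || P j))) = coord_submod he (fun j =>
    r j k && (~~ r k j || P j)).
Proof.
move=> gd gP; set Q := fun j => _.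
have E : coord_submod he Q = (\join_(j | Q j) (if P j then axis j else down j))%O.
  rewrite coord_submod_joinE; apply/le_anti/andP; split.
    apply/joinsP => j Qj; apply: le_trans (joins_sup _ Qj).
    by case: ifP => // _; apply: coord_submod_mono => i /eqP->; apply: rxx.
  apply/joinsP => j Qj; rewrite -coord_submod_joinE; case: ifP => Pj.
    by apply: coord_submod_mono => i /eqP->.
  apply: coord_submod_mono => i rij; move: Qj; rewrite /Q Pj orbF => /andP[rjk rkj].
  rewrite (rtr rij rjk) /=; apply/orP; left; apply: contra rkj => rki; exact: rtr rij.
rewrite E aut_bigjoin; apply: eq_bigr => j Qj; case: ifP => [/gP//|_]; exact: gd.
Qed.

Lemma vector_neq0 x : x <> 0 -> exists a, (eps * a) *: x <> 0.
Proof.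
move=> x0; apply: contrapT => h; apply: x0; apply: (coordinate_eq0 he) => i.
apply/eqP; apply: contraT => /(corner_mull_neq0 hS)[a]; rewrite -coordinateZ => /eqP na.
by exfalso; apply: h; exists a => E; apply: na; rewrite E;
  apply: (lform0 (coordinate_linform he i)).
Qed.

(** A nonzero v in the intersection has a nonzero coordinate at some l
equivalent to k and not yet treated; otherwise it would lie in a submodule fixed
by g that meets the axis k trivially. Since the intersection is nonzero, the
k-th coordinates of g (axis k) do not fill the k-th axis, and the transvection
from e_l to a missing vector of that axis moves v out of the intersection and
moves nothing into it. *)
Lemma shear_step g (P : pred 'I_n) k : fixdown g -> (forall b, P b -> g (axis b) = axis b) ->
  ~~ P k -> (g (axis k) `&` coaxis k <> \bot)%O ->
  exists u, [/\ F u, fixdown u, (forall b, P b -> u (axis b) = axis b) &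
    (u (g (axis k)) `&` coaxis k < g (axis k) `&` coaxis k)%O].
Proof.
move=> gd gP Pk N0.
have [v0 [Nv0 v0k] nzv0] : exists2 v, (g (axis k) `&` coaxis k)%O v & v <> 0.
  apply: contrapT => h; apply: N0; apply: submod_eqP => x; split=> [Nx|->]; last exact: submod_mem0.
  by apply: contrapT => x0; apply: h; exists x.
have [a0 nzv] := vector_neq0 nzv0.
set v := (eps * a0) *: v0 in nzv.
have ev : eps *: v = v by rewrite scalerA mulrA (eps_idem hS).
have Nv : g (axis k) v by apply: submod_scale.
have vk : coordinate v k = 0 by apply/coaxisP/submod_scale.
(* The indices strictly below k, and those of the class of k already treated. *)
pose Q j := r j k && (~~ r k j || P j).
have nQk : ~~ Q k by rewrite /Q rxx.
have [l vl nQl] : exists2 l, coordinate v l != 0 & ~~ Q l.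
  apply: contrapT => h.
  have Qv : coord_submod he Q v.
    by apply/coord_submodP => i Qi; apply/eqP; apply: contraT => vi; exfalso; apply: h; exists i.
  have : (g (axis k) `&` coord_submod he Q)%O v by [].
  rewrite -(below_fix k gd gP) -aut_meet.
  suff -> : (axis k `&` coord_submod he Q = \bot)%O by rewrite aut_bot.
  apply: submod_eqP => x; split=> [[/axisP -> /coord_submodP xQ]|->]; last exact: submod_mem0.
  by have := xQ k nQk; rewrite coordinateZ coordinate_self mulr1 => ->; rewrite scale0r.
have lk : l != k by apply: contraNneq vl => ->; rewrite vk.
have dv : down k v by apply: submod_le_mem Nv; rewrite -gd aut_leE;
  apply: coord_submod_mono => i /eqP->.
have rlk : r l k by apply: contraNT vl => /dv->.
move: nQl; rewrite /Q rlk /= negb_or negbK => /andP[rkl Pl].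
set W := (g (axis k) `|` coaxis k)%O.
have [b nb] : exists b, ~ W ((eps * b) *: e k).
  apply: contrapT => h; apply: N0; apply: (join_meet0 hS) => x.
  have We b : W ((eps * b) *: e k) by apply: contrapT => nb; apply: h; exists b.
  have Wk : W (e k).
    have [c [p [q E]]] := eps_span hS.
    rewrite -[e k]scale1r E scaler_suml; apply: submod_sum => a _.
    by rewrite -mulrA -scalerA; apply: submod_scale.
  have : (axis k `|` coaxis k <= W)%O.
    by rewrite leUx leUr andbT; apply: coord_submod_le => i /eqP->.
  by move=> /submod_le_mem; apply; apply: axis_join.
have evl : eps * coordinate v l = coordinate v l by rewrite -coordinateZ ev.
have [b' be bl] := right_eps hS evl vl.
have kl : k != l by rewrite eq_sym.
have fo : linform (fun x => coordinate x l * (b' * (eps * b)))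
  by exact: (lform_mulr (coordinate_linform he l)).
have un : invertible (1 + coordinate (e k) l * (b' * (eps * b))).
  by rewrite coordinate_other 1?eq_sym // mul0r addr0; apply: invertible1.
have [u [Fu ui uA]] := linear_in_shear_aut fo un (rF rkl kl _).
exists u; split => //.
- move=> s; apply: uA; case: (boolP (r l s)) => rls.
    by left; apply: coord_submod_basis; apply: rtr rls.
  by right=> x /coord_submodP-> //; rewrite mul0r.
- move=> c Pc; apply: uA; right => x /axisP->;
    rewrite coordinateZ coordinate_other ?mulr0 ?mul0r //.
  by apply: contraNneq Pl => <-.
set N := g (axis k).
have [w [w1 w2]] := un.
have key y : (u N `&` coaxis k)%O y -> (N `&` coaxis k)%O y /\ coordinate y l * b' = 0.
  rewrite -(shearVK fo w1 y); set x := shear _ _ y; rewrite submod_meetP -ui => -[Nx /coaxisP].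
  rewrite /shear coordinateD coordinateZ coordinate_self mulr1 => xk.
  have th0 : coordinate x l * b' = 0.
    apply/eqP; apply: contraT => th.
    have [|c _ cth] := left_eps hS _ th; first by rewrite -mulrA be.
    case: nb; have -> : (eps * b) *: e k = c *: ((coordinate x l * (b' * (eps * b))) *: e k).
      rewrite scalerA; congr (_ *: _); rewrite !mulrA in cth *;
        by rewrite cth -mulrA mulrA (eps_idem hS).
    apply: submod_scale;
      rewrite -[_ *: _](addKr (coordinate x k *: e k)) -scalerDl xk scale0r addr0.
    apply: submod_opp; apply/submod_joinP; exists x, (coordinate x k *: e k - x); split => //;
      last by rewrite addrC subrK.
    by apply/coaxisP;
      rewrite (lformB (coordinate_linform he k)) coordinateZ coordinate_self mulr1 subrr.
  have -> : x + (coordinate x l * (b' * (eps * b))) *: e k = x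
    by rewrite mulrA th0 mul0r scale0r addr0.
  split => //; split => //; apply/coaxisP; move: xk; by rewrite mulrA th0 mul0r addr0.
rewrite lt_neqAle; apply/andP; split; last by apply/submod_leP => y /key[].
apply/eqP => E; have /key[_ /eqP] : (u N `&` coaxis k)%O v by rewrite E; split=> //; apply/coaxisP.
rewrite bl; exact/negP/eps_neq0.
Qed.

Lemma position_step g (P : pred 'I_n) k : fixdown g -> (forall b, P b -> g (axis b) = axis b) ->
  ~~ P k ->
  exists u, [/\ F u, fixdown u, (forall b, P b -> u (axis b) = axis b) & u (g (axis k)) = axis k].
Proof.
have [d dP] := submod_rank hS he.
(* Induction on a bound for the rank of the intersection with coaxis k. *)
move: {2}(d _) (leqnn (d (g (axis k) `&` coaxis k)%O)) => c.
elim: c g => [|c IH] g dc gd gP Pk.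
  apply: (graph_step gd) => //; apply/eqP; apply: contraTT dc; rewrite -lt0x => /dP.
  by rewrite -ltnNge; apply: leq_ltn_trans.
have [E|/eqP N0] := eqVneq (g (axis k) `&` coaxis k)%O \bot%O; first exact: graph_step.
have [u [Fu ud uP /dP ult]] := shear_step gd gP Pk N0.
have [||||u' [Fu' ud' uP' u'k]] := IH (u * g)%g => //.
- by rewrite -ltnS; apply: leq_trans ult dc.
- exact: fixdownM.
- by move=> b Pb; rewrite aut_mulE gP // uP.
exists (u' * u)%g; split => //; first exact: subgroupM.
- exact: fixdownM.
- by move=> b Pb; rewrite aut_mulE uP // uP'.
Qed.

(** Gaussian elimination with submodules in place of column vectors: an
automorphism that fixes the generators is multiplied by elements of F until it
fixes every axis, and then lies in F by hypothesis. *)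
Lemma fixdown_sub g : fixdown g -> F g.
Proof.
move=> gd.
have [u [Fu uk]] : exists u, F u /\ forall k, k \in enum 'I_n -> (u * g)%g (axis k) = axis k.
  suff [u [Fu _ ?]] : exists u, [/\ F u, fixdown u &
      forall k, k \in enum 'I_n -> (u * g)%g (axis k) = axis k] by exists u.
  elim: (enum 'I_n) => [|k s [u [Fu ud us]]].
    by exists 1%g; split => //; apply: subgroup1.
  have [ks|ks] := boolP (k \in s).
    by exists u; split => // j; rewrite inE => /predU1P[->|]; apply: us.
  have [u' [Fu' ud' us' u'k]] := position_step (fixdownM ud gd) us ks.
  exists (u' * u)%g; split; [exact: subgroupM|exact: fixdownM|].
  move=> j; rewrite inE => /predU1P[->|js]; first exact: u'k.
  by have := us j js; rewrite !aut_mulE => ->; apply: us'.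
have Fug : F (u * g)%g by apply/hHF/(pstab_L0E he) => k; apply: uk; rewrite mem_enum.
have -> : g = (u^-1 * (u * g))%g.
  by apply: latAut_ext => A; rewrite !aut_mulE aut_invKE.
by apply: subgroupM => //; apply: subgroupV.
Qed.

End Elimination.

(** * Scalars in general position in a division ring *)

Section Division.
Variable S : pzRingType.
Hypothesis Sinv : forall x : S, x != 0 -> exists y, y * x = 1 /\ x * y = 1.
Hypothesis Sbig : more_than_six S.
Implicit Types x y s t u c k : S.

Lemma div_mulI x y z : x != 0 -> x * y = x * z -> y = z.
Proof. by move=> /Sinv[w [wx _]] /(congr1 ( *%R w)); rewrite !mulrA wx !mul1r. Qed.
Lemma div_Imul x y z : x != 0 -> y * x = z * x -> y = z.
Proof. by move=> /Sinv[w [_ xw]] /(congr1 ( *%R^~ w)); rewrite -!mulrA xw !mulr1. Qed.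
Lemma div_mul_neq0 x y : x != 0 -> y != 0 -> x * y != 0.
Proof.
by move=> x0 y0; apply: contra_neq y0; rewrite -[X in _ = X -> _](mulr0 x) => /(div_mulI x0).
Qed.

Lemma sq_one x : x * x = 1 -> x = 1 \/ x = -1.
Proof.
move=> xx; have E : (x - 1) * (x + 1) = 0.
  by rewrite mulrDr mulr1 mulrBl xx mul1r addrA subrK subrr.
have [/eqP|nx] := eqVneq x 1; first by rewrite -subr_eq0 => /eqP/subr0_eq; left.
right; apply/eqP; rewrite -addr_eq0; apply/eqP.
by apply: (@div_mulI (x - 1)); rewrite ?subr_eq0 // mulr0.
Qed.

(** If s^2 = -1 held for s and s + 1, then 2 s = -1 would leave a single
possibility for s. *)
Lemma exists_sq u : u + u = 1 -> exists s, [/\ s != 0, s != 1, s != -1 & s * s != -1].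
Proof.
move=> uu; apply: contrapT => h.
have {h}H s : s != 0 -> s != 1 -> s != -1 -> s * s = -1.
  by move=> s0 s1 sm; apply/eqP; apply: contraT => ss; exfalso; apply: h; exists s.
(* Avoids the exceptions for s and for s + 1, and the value s = -1/2. *)
have [|s] := Sbig (s := [:: 0; 1; -1; -1 - 1; - u]) => //.
rewrite !inE !negb_or => /and5P[s0 s1 sm1 sm2 su].
have ss := H s s0 s1 sm1.
have : (s + 1) * (s + 1) = -1.
  apply: H; [move: sm1|move: s0|move: sm2]; apply: contra_neq => /(canRL (addrK 1)) ->.
  - by rewrite sub0r.
  - by rewrite subrr.
  - by [].
rewrite mulrDr mulr1 mulrDl ss mul1r -addrA => /(canRL (addKr _)).
rewrite opprK subrr addrA => /(canRL (addrK 1)); rewrite sub0r => s2.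
case/eqP: su; rewrite -[s]mulr1 -uu mulrDr.
have su : s * u = u * s.
  have u2 : u * (1 + 1) = 1 by rewrite mulrDr mulr1.
  have u2' : (1 + 1) * u = 1 by rewrite mulrDl mul1r.
  have c2 : (1 + 1) * s = s * (1 + 1) by rewrite mulrDl mulrDr mulr1 mul1r.
  by rewrite -[RHS]mulr1 -u2' mulrA -[u * s * _]mulrA -c2 mulrA u2 mul1r.
by rewrite su -mulrDr s2 mulrN1.
Qed.

(** If s + 1/s equals k = 2 - c for s and for s + 1, then 2 s = k - 1. When
2 is invertible this determines s. When 2 = 0 it gives k = 1 and c = 1, so all
s other than 0 and 1 satisfy s^2 = s - 1; applied to s, t, s + t and s t this
forces t = 1 - s. Commutativity is not available, and quadratic equations may
have infinitely many roots, which is why s + 1 is brought in. *)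
Lemma exists_trace c : exists s, [/\ s != 0, s != 1, s != 1 - c &
  forall t, t * s = 1 -> s * t = 1 -> s + t != 1 + 1 - c].
Proof.
apply: contrapT; have [k kE] : exists k, k = 1 + 1 - c by exists (1 + 1 - c).
rewrite -kE => h.
have {h}H s : s != 0 -> s != 1 -> s != 1 - c -> s * s = s * k - 1.
  move=> s0 s1 sc; have [t [ts st]] := Sinv s0.
  have -> : k = s + t.
    apply/esym/eqP; apply: contraT => nk; exfalso; apply: h; exists s; split => // t' t's st'.
    suff -> : t' = t by [].
    by apply: (div_mulI s0); rewrite st.
  by rewrite mulrDr st addrK.
have sq s : s != 0 -> s != 1 -> s != -1 -> s != 1 - c -> s != - c -> s + s = k - 1.
  move=> s0 s1 sm sc sc'.
  have := H (s + 1).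
  have -> : s + 1 != 0.
    by move: sm; apply: contra_neq => /(canRL (addrK 1)) ->; rewrite sub0r.
  have -> : s + 1 != 1.
    by move: s0; apply: contra_neq => /(canRL (addrK 1)) ->; rewrite subrr.
  have -> : s + 1 != 1 - c.
    by move: sc'; apply: contra_neq => /(canRL (addrK 1)) ->; rewrite addrAC subrr add0r.
  move=> /(_ isT isT isT).
  rewrite mulrDr mulr1 mulrDl mul1r (H s) // mulrDl mul1r.
  rewrite -!addrA => /(can_inj (addKr (s * k))).
  by rewrite [s + (s + 1)]addrA addrC addrK.
have [two|two] := eqVneq (1 + 1 : S) 0; last first.
  have [u [_ u2]] := Sinv two.
  have [//|s] := Sbig (s := [:: 0; 1; -1; 1 - c; - c; (k - 1) * u]).
  rewrite !inE !negb_or => /and5P[s0 s1 sm sc /andP[sc' /eqP]]; apply.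
  by rewrite -(sq s) // -{2 3}[s]mulr1 -mulrDr -mulrA u2 mulr1.
have [//|s0] := Sbig (s := [:: 0; 1; -1; 1 - c; - c]).
rewrite !inE !negb_or => /and5P[s00 s01 s0m s0c s0c'].
have k1 : k = 1.
  apply/eqP; rewrite -subr_eq0 -(sq s0) //.
  by rewrite -{1}[s0]mulr1 -{2}[s0]mulr1 -mulrDr two mulr0.
have c1 : 1 - c = 0.
  by move: kE; rewrite k1 -addrA => /esym/(canRL (addKr _)); rewrite addNr.
(* From here on k = c = 1. *)
have {}H s : s != 0 -> s != 1 -> s * s = s - 1.
  by move=> s1 s2; rewrite H // ?k1 ?mulr1 // c1.
have [//|s] := Sbig (s := [:: 0; 1]); rewrite !inE negb_or => /andP[sn0 sn1].
have [//|t] := Sbig (s := [:: 0; 1; - s; 1 - s]).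
rewrite !inE !negb_or => /and4P[tn0 tn1 tns tn1s].
have ss := H s sn0 sn1; have tt := H t tn0 tn1.
(* The inverse of s is 1 - s, so the choice of t makes s t different from 1. *)
have sV : s * (1 - s) = 1 by rewrite mulrBr mulr1 ss opprB addrC subrK.
have pn1 : s * t != 1.
  by apply: contra_neq tn1s => E; apply: (div_mulI sn0); rewrite E sV.
have pp := H (s * t) (div_mul_neq0 sn0 tn0) pn1.
have stn0 : s + t != 0 by rewrite addrC addr_eq0.
have stn1 : s + t != 1.
  by move: tn1s; apply: contra_neq => <-; rewrite addrC addKr.
have q : t * s = 1 - s * t.
  have := H _ stn0 stn1; rewrite mulrDl !mulrDr ss tt => E.
  apply: (addrI (s - 1 + s * t)); apply: (addIr (t - 1)).
  by rewrite -addrA E [s - 1 + _ + _]addrACA subrr addr0 subrK addrA.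
(* Evaluate the square of s t through t s = 1 - s t. *)
have stE : s * t = s + t.
  apply: (addIr (-1)); rewrite -pp mulrA -[s * t * s]mulrA q mulrBr mulr1 mulrA ss.
  rewrite !mulrBl mul1r -mulrA tt mulrBr mulr1 opprB opprB.
  by rewrite addrCA [s * t + (s - _)]addrC subrK addrC addrA.
have : t - 1 = - s.
  apply: (@div_mulI (s - 1)); first by rewrite subr_eq0.
  rewrite mulrBr mulr1 mulrN !mulrBl ss !mul1r stE addrK.
  by rewrite [s - 1 - s]addrC addKr opprK opprB addrC subrK.
by move=> /(canRL (subrK 1)) tE; case/eqP: tn1s; rewrite tE addrC.
Qed.

End Division.

(** * Commutators that isolate an elementary transvection *)

Section Projection.
Variables (R : pzRingType) (M : lmodType R^c).
Implicit Types (A B : submod M).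

(** Complementary submodules give a linear projection, with which linear
forms vanishing on one of them are written down. *)
Lemma projection_exists A B : (A `&` B = \bot)%O -> (forall x, (A `|` B)%O x) ->
  exists p : M -> M, [/\ linear p, (forall x, A (p x)), (forall x, A x -> p x = x) &
    (forall x, B x -> p x = 0)].
Proof.
move=> AB0 top.
have /choice[p pP] : forall x, exists y, A y /\ B (x - y).
  by move=> x; have /submod_joinP[u [v [Au Bv ->]]] := top x; exists u; rewrite addrC addKr.
have uniq x y : A y -> B (x - y) -> p x = y.
  move=> Ay Bxy; have [Ap Bp] := pP x; apply/eqP; rewrite -subr_eq0; apply/eqP.
  have : (A `&` B)%O (p x - y).
    split; first exact: submod_sub.
    have -> : p x - y = (x - y) - (x - p x) by rewrite opprB [RHS]addrC addrA subrK.
    by apply: submod_sub.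
  by rewrite AB0.
exists p; split.
- move=> a x y; have [Ax Bx] := pP x; have [Ay By] := pP y; apply: uniq.
    exact: submod_lin.
  by rewrite opprD addrACA -scalerBr; apply: submod_lin.
- by move=> x; case: (pP x).
- by move=> x Ax; apply: uniq => //; rewrite subrr; apply: submod_mem0.
- by move=> x Bx; apply: uniq; [apply: submod_mem0|rewrite subr0].
Qed.
End Projection.

Section Commutators.
Variables (R : pzRingType) (eps : R^c) (hS : simple_artinian eps).
Hypothesis hTwo : two_vectors eps.
Variables (M : lmodType R^c) (n : nat) (e : 'I_n -> M) (he : is_basis e).
Variables (F : set (latAut (submod M))).
Hypothesis hF : subgroup F.
Hypothesis hHF : pstab (L0 e) `<=` F.
Implicit Types (A B C : submod M) (x y v : M) (i j k l : 'I_n).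
Implicit Types (g u : latAut (submod M)).

Local Notation axis := (axis he).
Local Notation coaxis := (coaxis he).
Local Notation coordinate := (coordinate he).
Local Notation elementary := (elementary he).
Local Notation linear_in := (linear_in F).
Let epsK := eps_idem hS.

Lemma linear_in_diag_coord k a b : invertible (1 + a * b) ->
  linear_in (shear (a *: e k) (fun x => coordinate x k * b)).
Proof.
move=> u; apply: (linear_in_diag hF hHF (k := k)).
- exact: (lform_mulr (coordinate_linform he k)).
- by rewrite coordinateZ coordinate_self mulr1.
- exact: axisZ.
- by move=> x /coaxisP->; rewrite mul0r.
Qed.

Lemma linear_in_elementary_mulr i j a c : i != j -> invertible c ->
  linear_in (elementary i j a) -> linear_in (elementary i j (a * c)).
Proof.
move=> ij [w [wc cw]] Lt.
have fo := lform_mulr (coordinate_linform he i) (c - 1).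
have E : 1 + coordinate (e i) i * (c - 1) = c by rewrite coordinate_self mul1r addrC subrK.
have LFd : linear_in (shear (e i) (fun x => coordinate x i * (c - 1))).
  rewrite -[e i]scale1r; apply: linear_in_diag_coord; rewrite mul1r addrC subrK.
  by exists w.
have h1 : w * (1 + coordinate (e i) i * (c - 1)) = 1 by rewrite E.
have h2 : (1 + coordinate (e i) i * (c - 1)) * w = 1 by rewrite E.
have := linear_in_conj hF (shear_linear (e i) fo) (shearK fo h2) (shearVK fo h1) LFd Lt.
congr linear_in; apply/funext => x; rewrite /elementary /shear /=.
have -> : e i + (coordinate (e i) i * (c - 1)) *: e i = c *: e i.
  by rewrite coordinate_self mul1r scalerBl scale1r addrC subrK.
by rewrite coordinateD coordinateZ -scaleNr coordinateZ (coordinate_other he ij) !mulr0 addr0 scalerA mulrA.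
Qed.

Lemma linear_in_elementary_mull i j a c : i != j -> invertible c ->
  linear_in (elementary i j a) -> linear_in (elementary i j (c * a)).
Proof.
move=> ij [w [wc cw]] Lt.
have fo := lform_mulr (coordinate_linform he j) (w - 1).
have E : 1 + coordinate (e j) j * (w - 1) = w by rewrite coordinate_self mul1r addrC subrK.
have LFd : linear_in (shear (e j) (fun x => coordinate x j * (w - 1))).
  rewrite -[e j]scale1r; apply: linear_in_diag_coord; rewrite mul1r addrC subrK.
  by exists c.
have h1 : c * (1 + coordinate (e j) j * (w - 1)) = 1 by rewrite E.
have h2 : (1 + coordinate (e j) j * (w - 1)) * c = 1 by rewrite E.
have := linear_in_conj hF (shear_linear (e j) fo) (shearK fo h2) (shearVK fo h1) LFd Lt.
congr linear_in; apply/funext => x;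
  rewrite /elementary /shear /= coordinate_other // mul0r scale0r addr0.
rewrite coordinateD coordinateZ -scaleNr coordinateZ coordinate_self mulr1 mulrN -mulrA [(w - 1) * c]mulrBl wc mul1r.
by rewrite mulrBr mulr1 opprB [coordinate x j + _]addrC subrK mulrA.
Qed.

(** The coefficients a for which the elementary transvection is induced in
F are closed under sums and, after conjugation by block diagonal units, under
multiplication by units on both sides. As units generate the ring, they form a
two-sided ideal. *)
Lemma linear_in_elementary_all i j : i != j ->
  (exists2 a, linear_in (elementary i j a) & a != 0) -> forall a, linear_in (elementary i j a).
Proof.
move=> ij.
have cancelN a : cancel (elementary i j a) (elementary i j (- a)) /\ cancel (elementary i j (- a)) (elementary i j a).
  have E0 b c : b + c = 0 -> elementary i j b \o elementary i j c = id.
    move=> bc; rewrite elementary_comp // bc /elementary; apply/funext => x.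
    by rewrite /shear mulr0 scale0r addr0.
  split=> x; [have := E0 (- a) a|have := E0 a (- a)]; rewrite ?addNr ?subrr => /(_ erefl).
  - by move=> /(congr1 (@^~ x)).
  - by move=> /(congr1 (@^~ x)).
have LN a : linear_in (elementary i j a) -> linear_in (elementary i j (- a)).
  by apply: linear_in_inv => //; case: (cancelN a).
have LD a b : linear_in (elementary i j a) -> linear_in (elementary i j b) ->
  linear_in (elementary i j (a + b)).
  by move=> La Lb; rewrite -elementary_comp //; apply: linear_in_comp.
have Il b : forall a, linear_in (elementary i j a) -> linear_in (elementary i j (b * a)).
  apply: (unit_span hS (P := fun b => forall a, linear_in (elementary i j a) ->
    linear_in (elementary i j (b * a)))).
  - by move=> c uc a La; apply: linear_in_elementary_mull.
  - by move=> b1 b2 h1 h2 a La; rewrite mulrBl; apply: LD; [apply: h1|apply/LN/h2].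
  - by move=> b1 b2 h1 h2 a La; rewrite -mulrA; apply/h1/h2.
have Ir b : forall a, linear_in (elementary i j a) -> linear_in (elementary i j (a * b)).
  apply: (unit_span hS (P := fun b => forall a, linear_in (elementary i j a) ->
    linear_in (elementary i j (a * b)))).
  - by move=> c uc a La; apply: linear_in_elementary_mulr.
  - by move=> b1 b2 h1 h2 a La; rewrite mulrBr; apply: LD; [apply: h1|apply/LN/h2].
  - by move=> b1 b2 h1 h2 a La; rewrite mulrA; apply/h2/h1.
by apply: (simple_ideal hS) => // a b La; split; [apply: Il|apply: Ir].
Qed.

(** The commutator of 1 + v phi with the block diagonal map 1 + p q. The
condition q v = 0 makes q invariant under the first factor, and the terms in p
cancel: the covector of the result is supported on the block of q. *)
Lemma linear_in_commutator_covector v phi p q w : linform phi -> invertible (1 + phi v) ->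
  linform q ->
  w * (1 + q p) = 1 -> linear_in (shear v phi) -> linear_in (shear p q) -> q v = 0 ->
  linear_in (shear v (fun x => q x * (w * phi p))).
Proof.
move=> hphi [z [z1 z2]] hq wq La Ld qv.
have := linear_in_conj hF (shear_linear v hphi) (shearK hphi z2) (shearVK hphi z1) La Ld.
have Ld' : linear_in (shear (- (w *: p)) q).
  apply: linear_in_inv Ld => //; exact: shearVK.
move=> /(linear_in_comp hF)/(_ Ld'); congr linear_in.
have hq' : q \o shear (- (z *: v)) phi = q.
  by apply/funext => x;
    rewrite /= /shear (lformD hq) (lformZ hq) (lformN hq) (lformZ hq) qv !(mulr0, oppr0) addr0.
rewrite hq'; apply/funext => x; rewrite /= shear_comp // (lformN hq) (lformZ hq).
have -> : q x + q x * - (w * q p) = q x * w.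
  rewrite -{1}[q x]mulr1 -mulrDr; congr (_ * _).
  by rewrite -wq mulrDr mulr1 addrK.
by rewrite /shear scalerN scalerDr !scalerA addrA subrK -!mulrA.
Qed.

(** A second commutator, with a block diagonal map on another block,
replaces the vector v by a vector of that block. *)
Lemma linear_in_commutator_vector v Q p q : linform Q -> linform q -> invertible (1 + q p) ->
  linear_in (shear v Q) -> linear_in (shear p q) -> Q v = 0 -> Q p = 0 ->
    linear_in (shear p (fun x => Q x * q v)).
Proof.
move=> hQ hq [z [z1 z2]] Lb Ld Qv Qp.
have := linear_in_conj hF (shear_linear p hq) (shearK hq z2) (shearVK hq z1) Ld Lb.
have Lb' : linear_in (shear (- v) Q).
  rewrite -[v]scale1r; apply: linear_in_inv Lb => //; apply: shearVK => //.
  by rewrite Qv addr0 mulr1.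
move=> /(linear_in_comp hF)/(_ Lb'); congr linear_in.
have hQ' : Q \o shear (- (z *: p)) q = Q.
  by apply/funext => x;
    rewrite /= /shear (lformD hQ) (lformZ hQ) (lformN hQ) (lformZ hQ) Qp !(mulr0, oppr0) addr0.
rewrite hQ'; apply/funext => x; rewrite /= shear_comp // (lformN hQ) Qv oppr0 mulr0 addr0.
by rewrite /shear scalerN scalerDr !scalerA addrA subrK.
Qed.

(** Provides a block diagonal map 1 + l m on one block that is invertible and
moves a vector with coordinate c on that block. *)
Lemma corner_choice c : eps * c = c -> c != 0 -> exists l m : R^c, [/\ eps * l = l, l != 0,
   m * eps = m, c * m = eps & invertible (1 + l * m)].
Proof.
move=> ec c0; have [m me cm] := right_eps hS ec c0.
have key (l : R^c) : eps * l = l -> l * m != - eps -> invertible (1 + l * m).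
  move=> el lm; have [|w [w1 w2 _]] := corner_unit hS _ lm; last by exists w.
  by split; [rewrite mulrA el|rewrite -mulrA me].
have [l1 [l2 [l12 l1n l2n e1 e2]]] := hTwo.
(* If l1 m = l2 m = - eps, the difference l1 - l2 satisfies (l1 - l2) m = 0. *)
have [E1|n1] := eqVneq (l1 * m) (- eps); last by exists l1, m; split => //; apply: key.
have [E2|n2] := eqVneq (l2 * m) (- eps); last by exists l2, m; split => //; apply: key.
exists (l1 - l2), m; split => //; first by rewrite mulrBr e1 e2.
  by rewrite subr_eq0.
rewrite mulrBl E1 E2 subrr; exists 1; by rewrite addr0 mulr1.
Qed.

(** Two commutators turn 1 + v phi into an elementary transvection from e_j
to e_i. The first, with a map on block j whose covector kills v, confines the
covector to block j; the second, with a map on block i, confines the vector to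
block i. *)
Lemma elementary_from_shear i j v phi (l m : R^c) : i != j -> eps *: v = v -> coordinate v i != 0 ->
  linform phi -> (forall x, phi x * eps = phi x) -> invertible (1 + phi v) ->
    linear_in (shear v phi) ->
  m * eps = m -> m != 0 -> eps * l = l -> coordinate v j * m = 0 -> l * phi (e j) != 0 ->
  l * m != - eps -> exists2 a, linear_in (elementary i j a) & a != 0.
Proof.
move=> ij ev vi hphi phie uphi La me m0 el vm lphi lm.
have cl : corner eps (l * m) by split; [rewrite mulrA el|rewrite -mulrA me].
have [w [w1 w2 we]] := corner_unit hS cl lm.
have hq := lform_mulr (coordinate_linform he j) m.
have := linear_in_commutator_covector (p := l *: e j) (q := fun x =>
  coordinate x j * m) (w := w) hphi uphi hq.
rewrite coordinateZ coordinate_self mulr1 =>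
  /(_ w1 La (linear_in_diag_coord _ (ex_intro _ w (conj w1 w2))) vm).
rewrite (lformZ hphi); set z := w * _ => Lb.
have z0 : z != 0.
  apply: contra_neq lphi => z0; rewrite -[l * _]mul1r -w2 -mulrA -/z z0 mulr0 //.
have cz : corner eps z.
  split; last by rewrite /z -!mulrA phie.
  by rewrite /z mulrA -we -mulrA [eps * (l * _)]mulrA el.
have ec : eps * coordinate v i = coordinate v i by rewrite -coordinateZ ev.
have [l' [m' [el' l'0 me' vm' u']]] := corner_choice ec vi.
have hQ : linform (fun x => coordinate x j * m * z) by exact: lform_mulr.
have hq' := lform_mulr (coordinate_linform he i) m'.
have := linear_in_commutator_vector (p := l' *: e i) hQ hq'.
rewrite coordinateZ coordinate_self mulr1 => /(_ v u' Lb (linear_in_diag_coord _ u')).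
rewrite vm mul0r coordinateZ coordinate_other // !(mulr0, mul0r) vm' => /(_ erefl erefl) Lc.
exists (m * z * l'); last exact: (eps_mul_neq0 hS).
move: Lc; congr linear_in; apply/funext => x; rewrite /elementary /shear scalerA.
by rewrite -!mulrA; congr (_ + (_ * (_ * _)) *: _); rewrite [eps * _]el'.
Qed.

End Commutators.

(** * Moved axes produce elementary transvections: matrices of size at least two *)

Section Claim.
Variables (R : pzRingType) (eps : R^c) (hS : simple_artinian eps).
Hypothesis hTwo : two_vectors eps.
Variables (M : lmodType R^c) (n : nat) (e : 'I_n -> M) (he : is_basis e).
Variables (F : set (latAut (submod M))).
Hypothesis hF : subgroup F.
Hypothesis hHF : pstab (L0 e) `<=` F.
Implicit Types (A B C : submod M) (x y v : M) (i j k l : 'I_n).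
Implicit Types (g u : latAut (submod M)).

Local Notation axis := (axis he).
Local Notation coaxis := (coaxis he).
Local Notation coordinate := (coordinate he).
Local Notation elementary := (elementary he).
Local Notation linear_in := (linear_in F).
Let epsK := eps_idem hS.

Lemma conj_complement g k : (g (axis k) `&` g (coaxis k) = \bot)%O /\
  (forall x, (g (axis k) `|` g (coaxis k))%O x).
Proof.
split; first by rewrite -aut_meet axis_meet aut_bot.
move=> x; rewrite -aut_join; apply: submod_le_mem (cyclic_sub_id x).
rewrite -[cyclic_sub x](aut_KinvE g) aut_leE; apply/submod_leP => y _; exact: axis_join.
Qed.

Lemma line_exists g i k : ~~ (g (axis k) <= coaxis i)%O ->
  exists v, [/\ g (axis k) v, eps *: v = v & coordinate v i != 0].
Proof.
move=> /negP nle; have [x Ax xi] : exists2 x, g (axis k) x & coordinate x i != 0.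
  apply: contrapT => h; apply: nle; apply/submod_leP => x Ax; apply/coaxisP/eqP.
  by apply: contraT => xi; exfalso; apply: h; exists x.
have [a ax] := corner_mull_neq0 hS xi; exists ((eps * a) *: x); split.
- exact: submod_scale.
- by rewrite scalerA mulrA epsK.
- by rewrite coordinateZ.
Qed.

(** A linear form on M that factors through the projection onto
g (axis k) along g (coaxis k). *)
Definition covector g k (phi : M -> R^c) :=
  [/\ linform phi, forall x, phi x * eps = phi x & forall x, g (coaxis k) x -> phi x = 0].

Lemma covector_exists g k y : ~ g (coaxis k) y ->
  exists2 phi, covector g k phi & phi y != 0.
Proof.
move=> ny; have [AB top] := conj_complement g k.
have [p [lp pA pid pB]] := projection_exists AB top.
have [l pl] : exists l, coordinate (p y) l != 0.
  apply: contrapT => h; apply: ny.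
  have py0 : p y = 0.
    by apply: (coordinate_eq0 he) => l; apply/eqP; apply: contraT => pl; exfalso; apply: h;
      exists l.
  have /submod_joinP[u [w [Au Bw yE]]] := top y.
  have pD a b : p (a + b) = p a + p b by rewrite -[a in LHS]scale1r lp scale1r.
  by move: py0; rewrite yE pD (pid u Au) (pB w Bw) addr0 => ->; rewrite add0r.
have [b pb] := corner_mulr_neq0 hS pl.
exists (fun x => coordinate (p x) l * b * eps) => //; split.
- apply: lform_mulr; apply: lform_mulr; exact: (lform_comp (coordinate_linform he l)).
- by move=> x; rewrite -mulrA epsK.
- by move=> x /pB->; rewrite (lform0 (coordinate_linform he l)) !mul0r.
Qed.

Lemma covector_mulr g k phi c : covector g k phi -> c * eps = c ->
  covector g k (fun x => phi x * c).
Proof.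
move=> [h1 h2 h3] ec; split; first exact: lform_mulr.
- by move=> x; rewrite -mulrA ec.
- by move=> x /h3->; rewrite mul0r.
Qed.

Lemma covector_add g k phi psi : covector g k phi -> covector g k psi ->
  covector g k (fun x => phi x + psi x).
Proof.
move=> [h1 h2 h3] [k1 k2 k3]; split; first exact: lform_add.
- by move=> x; rewrite mulrDl h2 k2.
- by move=> x xB; rewrite h3 // k3 // addr0.
Qed.

Lemma covector_corner g k phi v : covector g k phi -> eps *: v = v -> corner eps (phi v).
Proof. by move=> [h1 h2 _] ev; split => //; rewrite -(lformZ h1) ev. Qed.

Section HigherRank.
Hypothesis hB : two_covectors eps.

(** An axis has rank at least two, so it properly contains a nonzero cyclic
submodule generated by a vector; its image cannot be generated by a vector,
since any nonzero submodule of cyclic_sub v contains v. *)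
Lemma not_line g k v : eps *: v = v -> ~ (g (axis k) <= cyclic_sub v)%O.
Proof.
move=> ev le.
have [m [_ [[_ m0 _ me _] [em _]]]] := hB epsK.
have lt : (cyclic_sub (eps *: e k) < axis k)%O.
  rewrite lt_neqAle; apply/andP; split; last by apply/cyclic_sub_le/axisZ.
  apply/eqP => E; have /cyclic_subP[s] : cyclic_sub (eps *: e k) (e k) by rewrite E;
    apply: axis_basis.
  move=> /(congr1 (coordinate^~ k)); rewrite /= scalerA coordinateZ coordinate_self mulr1 => s1.
  by case/eqP: m0; rewrite -[m]mul1r s1 -mulrA em mulr0.
have gX0 : (g (cyclic_sub (eps *: e k)) <> \bot)%O.
  rewrite -(aut_bot g) => /(can_inj (aut_funK g)) E.
  have : (\bot%O : submod M) (eps *: e k) by rewrite -E; apply: cyclic_sub_id.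
  move=> /submod_botP/(congr1 (coordinate^~ k)).
  rewrite /= coordinateZ coordinate_self mulr1 (lform0 (coordinate_linform he k)) => /eqP;
    exact/negP/(eps_neq0 hS).
have [x gx x0] : exists2 x, g (cyclic_sub (eps *: e k)) x & x <> 0.
  apply: contrapT => h; apply: gX0; apply: submod_eqP => x; split=> [gx|->];
    last exact: submod_mem0.
  by apply: contrapT => x0; apply: h; exists x.
have /cyclic_subP[s xs] : cyclic_sub v x.
  by apply: submod_le_mem le _; apply: submod_le_mem gx; rewrite aut_leE ltW.
have se0 : s * eps != 0.
  by apply/eqP => E; apply: x0; rewrite xs -ev scalerA E scale0r.
have [|a _ ase] := left_eps hS _ se0; first by rewrite -mulrA epsK.
have gv : g (cyclic_sub (eps *: e k)) v.
  have -> : v = a *: x by rewrite xs scalerA -{2}ev scalerA -mulrA ase.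
  exact: submod_scale.
have := le_trans le (cyclic_sub_le gv); rewrite aut_leE => /le_lt_trans/(_ lt).
by rewrite ltxx.
Qed.

(** Start from any v and phi with the two nonvanishing properties, scaled so
that phi v = eps if it is not zero. As g (axis k) is not generated by v, there
are a vector w killed by phi and a covector psi with psi v = 0, psi w = eps. One
of (w, phi), (v, psi), (v + w, phi - psi) is then a solution. *)
Lemma isotropic_pair g i j k : ~~ (g (axis k) <= coaxis i)%O -> ~~ (axis j <= g (coaxis k))%O ->
  exists v phi, [/\ g (axis k) v, eps *: v = v, coordinate v i != 0,
    covector g k phi & phi (e j) != 0 /\ phi v = 0].
Proof.
move=> hi hj.
have [v [Av ev vi]] := line_exists hi.
have nej : ~ g (coaxis k) (e j).
  by move=> ej; move/negP: hj; apply; apply: coord_submod_le => l /eqP->.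
have [phi0 cphi0 phi0j] := covector_exists nej.
have [E|nz] := eqVneq (phi0 v) 0; first by exists v, phi0.
have cz := covector_corner cphi0 ev.
have [z [[ez ze] zv vz]] := corner_inv hS cz nz.
have cphi := covector_mulr cphi0 ze.
have phij : phi0 (e j) * z != 0.
  apply: contra_neq phi0j => E.
  have [_ h _] := cphi0.
  by rewrite -h -zv mulrA E mul0r.
move: cphi phij vz; set phi := fun x => phi0 x * z; rewrite -/(phi _) => cphi phij phiv.
have [fphi phie phiB] := cphi.
have [w [Aw ew w0 phiw]] : exists w, [/\ g (axis k) w, eps *: w = w, w <> 0 & phi w = 0].
  have [y Ay ny] : exists2 y, g (axis k) y & ~ cyclic_sub v y.
    apply: contrapT => h; apply: (@not_line g k v ev); apply/submod_leP => y Ay.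
    by apply: contrapT => ny; apply: h; exists y.
  have y0 : y - phi y *: v <> 0.
    by move/eqP; rewrite subr_eq0 => /eqP E; apply: ny; apply/cyclic_subP; exists (phi y).
  have [a na] := vector_neq0 hS he y0.
  exists ((eps * a) *: (y - phi y *: v)); split => //.
  - by apply/submod_scale/submod_sub => //; apply: submod_scale.
  - by rewrite scalerA mulrA epsK.
  - by rewrite (lformZ fphi) (lformB fphi) (lformZ fphi) [phi v]phiv phie subrr mulr0.
have nw : ~ g (coaxis k) w.
  move=> Bw; apply: w0; have : (g (axis k) `&` g (coaxis k))%O w by [].
  by have [-> _] := conj_complement g k.
have [psi0 cpsi0 psi0w] := covector_exists nw.
have [z' [[ez' ze'] z'w wz']] := corner_inv hS (covector_corner cpsi0 ew) psi0w.
have cpsi1 := covector_mulr cpsi0 ze'.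
move: cpsi1 wz'; set psi1 := fun x => psi0 x * z'; rewrite -/(psi1 _) => cpsi1 psi1w.
have [ec _] := covector_corner cpsi1 ev.
have cpsi2 : covector g k (fun x => phi x * - psi1 v).
  by apply: covector_mulr => //; have [_ h _] := cpsi1; rewrite mulNr h.
have cpsi := covector_add cpsi1 cpsi2.
move: cpsi; set psi := fun x => _ => cpsi.
have psiv : psi v = 0 by rewrite /psi [phi v]phiv mulrN ec subrr.
have psiw : psi w = eps by rewrite /psi phiw mul0r addr0.
have [fpsi psie psiB] := cpsi.
have [wi|wi] := eqVneq (coordinate w i) 0; last by exists w, phi.
have [psij|psij] := eqVneq (psi (e j)) 0; last by exists v, psi.
have cN : covector g k (fun x => psi x * - eps).
  by apply: covector_mulr => //; rewrite mulNr epsK.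
exists (v + w), (fun x => phi x + psi x * - eps); split.
- exact: submod_add.
- by rewrite scalerDr ev ew.
- by rewrite coordinateD wi addr0.
- exact: covector_add.
- split; first by rewrite psij mul0r addr0.
  rewrite (lformD fphi) (lformD fpsi) phiw [phi v]phiv psiv psiw addr0 add0r mulrN epsK subrr //.
Qed.

(** The transvection given by an isotropic pair is in F; it remains to
choose a covector m on block j killing v with l m <> - eps. If two distinct
choices both fail, their difference succeeds. *)
Lemma elementary_higher_rank g i j k : F g -> i != j -> ~~ (g (axis k) <= coaxis i)%O ->
  ~~ (axis j <= g (coaxis k))%O -> exists2 a, linear_in (elementary i j a) & a != 0.
Proof.
move=> Fg ij hi hj.
have [v [phi [Av ev vi [fphi phie phiB] [phij phiv]]]] := isotropic_pair hi hj.
have u1 : invertible (1 + phi v) by rewrite phiv addr0; apply: invertible1.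
have La : linear_in (shear v phi) by apply: (linear_in_moved_shear hF hHF Fg fphi u1 Av).
have evj : eps * coordinate v j = coordinate v j by rewrite -coordinateZ ev.
have [l el lphi] := left_eps hS (phie (e j)) phij.
have lphi0 : l * phi (e j) != 0 by rewrite lphi; apply: eps_neq0.
have ext (m : R^c) := @elementary_from_shear _ _ hS hTwo _ _ _ he F hF hHF i j v phi l m ij ev vi fphi phie u1 La.
have [m1 [m2 [[m12 m10 m20 me1 me2] [vm1 vm2]]]] := hB evj.
have [E1|n1] := eqVneq (l * m1) (- eps); last exact: (ext m1).
have [E2|n2] := eqVneq (l * m2) (- eps); last exact: (ext m2).
apply: (ext (m1 - m2)) => //.
- by rewrite mulrBl me1 me2.
- by rewrite subr_eq0.
- by rewrite mulrBr vm1 vm2 subrr.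
- by rewrite mulrBr E1 E2 subrr eq_sym oppr_eq0; apply: eps_neq0.
Qed.
End HigherRank.
End Claim.

(** * Moved axes produce elementary transvections: division rings *)

Section Division.
Variables (R : pzRingType) (hS : simple_artinian (1 : R^c)).
Hypothesis hTwo : two_vectors (1 : R^c).
Hypothesis Sbig : more_than_six R^c.
Variables (M : lmodType R^c) (n : nat) (e : 'I_n -> M) (he : is_basis e).
Variables (F : set (latAut (submod M))).
Hypothesis hF : subgroup F.
Hypothesis hHF : pstab (L0 e) `<=` F.
Implicit Types (A B C : submod M) (x y v : M) (i j k l : 'I_n).
Implicit Types (g u : latAut (submod M)).

Local Notation axis := (axis he).
Local Notation coaxis := (coaxis he).
Local Notation coordinate := (coordinate he).
Local Notation elementary := (elementary he).
Local Notation linear_in := (linear_in F).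

Lemma Sinv (x : R^c) : x != 0 -> exists y : R^c, y * x = 1 /\ x * y = 1.
Proof.
move=> x0; have [|y [_ yx xy]] := corner_inv hS _ x0; last by exists y.
by split; rewrite ?mul1r ?mulr1.
Qed.
Let mulI := div_mulI Sinv.
Let Imul := div_Imul Sinv.
Let mul_neq0 := div_mul_neq0 Sinv.

(** With phi v = 1 this multiplies v by s and fixes the kernel of phi. *)
Definition homothety v phi (s : R^c) := shear v (fun x => phi x * (s - 1)).

(** A line and a hyperplane for which F contains all the dilatations. *)
Definition full_pair v phi := [/\ linform phi, phi v = 1 &
  forall s : R^c, s != 0 -> linear_in (homothety v phi s)].

Lemma homothety_comp v phi (s t : R^c) x : linform phi -> phi v = 1 ->
  homothety v phi s (homothety v phi t x) = homothety v phi (t * s) x.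
Proof.
move=> fphi pv; rewrite /homothety shear_comp; last exact: lform_mulr.
rewrite pv mul1r -addrA -scalerDl /shear; congr (_ + _ *: _).
rewrite -mulrA -!mulrDr; congr (_ * _).
by rewrite [(t - 1) * _]mulrBl mul1r [_ + (t * _ - _)]addrC subrK mulrBr mulr1 addrC addrA subrK.
Qed.

Lemma homothety1 v phi x : homothety v phi 1 x = x.
Proof. by rewrite /homothety /shear subrr mulr0 scale0r addr0. Qed.

Lemma invertible_neq0 (s : R^c) : s != 0 -> invertible s.
Proof. by move=> /Sinv[t []]; exists t. Qed.

(** Conjugating the dilatations along e_k by one of those along v produces
new pairs. The three steps below iterate this until the vector of the pair has
j-th coordinate 0. *)
Lemma full_pair_conj v phi (s t : R^c) k : full_pair v phi -> t * s = 1 -> s * t = 1 -> s != 0 ->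
  full_pair (e k + (phi (e k) * (s - 1)) *: v) (fun x =>
    coordinate x k + phi x * (t - 1) * coordinate v k).
Proof.
move=> [fphi pv Lv] ts st s0.
set psi := fun x => _.
have fs q := lform_mulr fphi (q - 1).
have K1 : cancel (homothety v phi s) (homothety v phi t).
  by move=> x; rewrite homothety_comp // st homothety1.
have K2 : cancel (homothety v phi t) (homothety v phi s).
  by move=> x; rewrite homothety_comp // ts homothety1.
(* The new form is the k-th coordinate composed with the inverse dilatation. *)
have psiE x : psi x = coordinate (homothety v phi t x) k by rewrite coordinateD coordinateZ.
split.
- apply: lform_add; first exact: coordinate_linform.
  by apply: lform_mulr; apply: lform_mulr.
- by rewrite psiE -[X in homothety v phi t X]/(homothety v phi s (e k)) K1 coordinate_self.
- move=> q q0.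
  have uq : invertible (1 + 1 * (q - 1)) by rewrite mul1r addrC subrK; apply: invertible_neq0.
  have := linear_in_diag_coord he hF hHF k uq; rewrite scale1r => Ld.
  have := linear_in_conj hF (shear_linear v (fs s)) K1 K2 (Lv s s0) Ld.
  by congr linear_in; apply/funext => x; rewrite /homothety /shear /= psiE.
Qed.

Section Pair.
Variables (i j : 'I_n).
Hypothesis ij : i != j.
Let ji : j != i. Proof. by rewrite eq_sym. Qed.
Let goal := exists2 a, linear_in (elementary i j a) & a != 0.

(** Any covector supported on block j kills v, as elementary_from_shear
requires. *)
Lemma pair_orthogonal v phi : full_pair v phi -> coordinate v i != 0 -> phi (e j) != 0 ->
  coordinate v j = 0 -> goal.
Proof.
move=> [fphi pv Lv] vi pj vj.
have [//|s] := Sbig (s := [:: 0; 1]); rewrite !inE negb_or => /andP[s0 s1].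
have [//|m] := Sbig (s := [:: 0; -1]); rewrite !inE negb_or => /andP[m0 m1].
have sm1 : s - 1 != 0 by rewrite subr_eq0.
apply: (@elementary_from_shear _ _ hS hTwo _ _ _ he F hF hHF i j v (fun x =>
  phi x * (s - 1)) 1 m) => //.
- exact: scale1r.
- exact: lform_mulr.
- by move=> x; rewrite mulr1.
- by rewrite pv mul1r addrC subrK; apply: invertible_neq0.
- exact: Lv.
- exact: mulr1.
- exact: mul1r.
- by rewrite vj mul0r.
- by rewrite mul1r mul_neq0.
- by rewrite mul1r.
Qed.

(** Let u be the product of v_j and phi_j. Conjugating e_j by the
dilatation of ratio s = 1 - 1/u gives a vector with j-th coordinate
1 - phi_j (1/u) v_j = 0. The covector keeps a nonzero j-th entry unless s^2 = 1,
that is unless u = 1/2. *)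
Lemma pair_generic v phi : full_pair v phi -> coordinate v i != 0 -> phi (e j) != 0 ->
  coordinate v j * phi (e j) != 1 ->
    coordinate v j * phi (e j) + coordinate v j * phi (e j) != 1 -> goal.
Proof.
move=> fp vi pj u1 u2.
have [vj|vj] := eqVneq (coordinate v j) 0; first exact: pair_orthogonal fp vi pj vj.
have u0 : coordinate v j * phi (e j) != 0 by apply: mul_neq0.
have [c [cu uc]] := Sinv u0.
have c0 : c != 0 by apply: contra_neq u0 => c0; rewrite -[LHS]mulr1 -uc c0 !mulr0.
have s0 : 1 - c != 0.
  rewrite subr_eq0; apply: contra_neq u1 => c1; by rewrite -uc -c1 mulr1.
have [t [ts st]] := Sinv s0.
have sE : 1 - c - 1 = - c by rewrite addrAC subrr add0r.
have E : 1 + phi (e j) * (1 - c - 1) * coordinate v j = 0.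
  have P : phi (e j) * c * coordinate v j = 1.
    by apply: (mulI vj); rewrite mulr1 !mulrA uc mul1r.
  by rewrite sE mulrN mulNr P subrr.
apply: (pair_orthogonal (full_pair_conj j fp ts st s0)).
- rewrite coordinateD coordinateZ coordinate_other // add0r !mul_neq0 // sE oppr_eq0 //.
- rewrite coordinate_self; apply/eqP => E'.
  (* A zero j-th entry of the covector would give s = 1/s. *)
  have ts' : t = 1 - c.
    apply: (addIr (-1)); apply: (mulI pj); apply: (Imul vj); apply: (addrI 1).
    by rewrite E E'.
  have : (1 - c) * (1 - c) = 1 by rewrite -{1}ts'.
  move=> /(sq_one Sinv)[|] /(canRL (addKr _)).
  + by rewrite addNr => /eqP; rewrite oppr_eq0; apply/negP.
  + move=> /eqP; rewrite eqr_oppLR opprD !opprK => /eqP cE.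
    by case/eqP: u2; rewrite -{1 2}[_ * _]mulr1 -mulrDr -cE.
- by rewrite coordinateD coordinateZ coordinate_self E.
Qed.

(** It remains to treat u = 1/2. Then u is central, and conjugating e_j by
the dilatation of ratio s replaces u by a conjugate of
(1 + s)(1 + 1/s) / 4. This is 1 only for s = 1 and 1/2 only for s^2 = -1. The
field with five elements has no suitable s. *)
Lemma pair_not_one v phi : full_pair v phi -> coordinate v i != 0 -> phi (e j) != 0 ->
  coordinate v j * phi (e j) != 1 -> goal.
Proof.
move=> fp vi pj u1.
have [uu|] := eqVneq (coordinate v j * phi (e j) + coordinate v j * phi (e j)) 1;
  last exact: pair_generic fp vi pj u1.
set u := coordinate v j * phi (e j) in uu u1.
have [s [s0 s1 sm ss]] := exists_sq Sbig uu.
have [t [ts st]] := Sinv s0.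
have u0 : u != 0.
  by apply/eqP => u0; have := eps_neq0 hS; rewrite -uu u0 addr0 eqxx.
have t1m : 1 + t != 0.
  rewrite addrC addr_eq0; apply: contra_neq sm => tE; move: st; rewrite tE mulrN1.
  by move=> <-; rewrite opprK.
have u2 : u * (1 + 1) = 1 by rewrite mulrDr mulr1.
have u2' : (1 + 1) * u = 1 by rewrite mulrDl mul1r.
(* The element 1/2 is central. *)
have uC (x : R^c) : u * x = x * u.
  have c2 : (1 + 1) * x = x * (1 + 1) by rewrite mulrDl mulrDr mulr1 mul1r.
  by rewrite -[LHS]mulr1 -u2' mulrA -[u * x * _]mulrA -c2 mulrA u2 mul1r.
have key (q : R^c) : (1 + phi (e j) * (q - 1) * coordinate v j) * phi (e j) = phi (e j)
  * ((1 + q) * u).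
  rewrite mulrDl mul1r -mulrA -/u -mulrA -{1}[phi _]mulr1 -mulrDr; congr (_ * _).
  by rewrite mulrBl mul1r mulrDl mul1r -[X in X + _]uu addrC addrA subrK addrC.
set D := (1 + s) * (1 + t).
have DE : D = 1 + 1 + (s + t).
  by rewrite /D mulrDr mulr1 mulrDl mul1r st [t + 1]addrC addrACA.
have XY : (1 + phi (e j) * (s - 1) * coordinate v j) * (1 + phi (e j) * (t - 1)
  * coordinate v j) * phi (e j)
    = phi (e j) * (D * u * u).
  have mul (X Y a b c : R^c) : X * c = c * (a * u) -> Y * c = c * (b * u) ->
      X * Y * c = c * (a * b * u * u).
    move=> hX hY; rewrite -[X * Y * c]mulrA hY mulrA hX -!mulrA.
    have E z : coordinate v j * (phi (e j) * z) = z * u by rewrite -uC /u mulrA.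
    by rewrite !E -mulrA.
  exact: mul (key s) (key t).
have sm1 : s - 1 != 0 by rewrite subr_eq0.
apply: (pair_generic (full_pair_conj j fp ts st s0)).
- by rewrite coordinateD coordinateZ coordinate_other // add0r; apply: mul_neq0 vi; apply: mul_neq0.
- rewrite coordinate_self; apply/eqP => E.
  have : phi (e j) * ((1 + t) * u) != 0 by apply: mul_neq0 => //; apply: mul_neq0.
  by rewrite -key E mul0r eqxx.
- rewrite coordinateD coordinateZ coordinate_self; apply/eqP => E.
  have DD : D = (1 + 1) * (1 + 1).
    have : phi (e j) * (D * u * u) = phi (e j) * 1 by rewrite -XY E mul1r mulr1.
    move=> /(mulI pj) E'; apply: (Imul u0); apply: (Imul u0).
    by rewrite E' -[_ * (1 + 1) * u]mulrA u2' mulr1 u2'.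
  have {DD} : s + t = 1 + 1.
    by apply: (addrI (1 + 1)); rewrite -DE DD mulrDr !mulr1.
  move=> /(congr1 ( *%R s)); rewrite mulrDr st mulrDr mulr1 => E2.
  case/eqP: s1; apply/eqP; rewrite -subr_eq0; apply/eqP.
  apply: (mulI sm1); rewrite mulr0 mulrBr mulr1 mulrBl mul1r opprB.
  by rewrite addrACA E2 -opprD subrr.
- rewrite coordinateD coordinateZ coordinate_self; apply/eqP => E.
  have DD : D = 1 + 1.
    apply: (Imul u0); rewrite u2'; apply: (mulI pj); rewrite mulr1.
    have DuE : D * u = D * u * u + D * u * u by rewrite -mulrDr uu mulr1.
    by rewrite DuE mulrDr -XY -mulrDl E mul1r.
  have : s + t = 0.
    by apply: (addrI (1 + 1)); rewrite -DE DD addr0.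
  move=> /(congr1 ( *%R s)); rewrite mulrDr st mulr0 => /eqP; rewrite addr_eq0; exact/negP.
Qed.

(** It remains to treat u = 1, where conjugating e_j does not change u.
Conjugating e_i instead replaces u by phi_i (s - 1)(1/s - 1) v_i, and s is
chosen so that this is not 1 and the new i-th coordinate is not 0. *)
Lemma full_pair_elementary v phi : full_pair v phi -> coordinate v i != 0 -> phi (e j) != 0 -> goal.
Proof.
move=> fp vi pj.
have [u1|] := eqVneq (coordinate v j * phi (e j)) 1; last exact: pair_not_one fp vi pj.
have finish (s t : R^c) : s != 0 -> s != 1 -> t * s = 1 -> s * t = 1 ->
  1 + phi (e i) * (s - 1) * coordinate v i != 0 ->
  phi (e i) * ((s - 1) * (t - 1)) * coordinate v i != 1 -> goal.
  move=> s0 s1 ts st wi u'.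
  have t1 : t - 1 != 0.
    by rewrite subr_eq0; apply: contra_neq s1 => t1; rewrite -st t1 mulr1.
  apply: (pair_not_one (full_pair_conj i fp ts st s0)).
  - by rewrite coordinateD coordinateZ coordinate_self.
  - by rewrite coordinate_other // add0r; apply: mul_neq0 vi; apply: mul_neq0.
  - rewrite coordinateD coordinateZ !coordinate_other // !add0r.
    by rewrite !mulrA -[_ * coordinate v j * _]mulrA u1 mulr1 -!mulrA mulrA in u' *.
have [pi|pi] := eqVneq (phi (e i)) 0.
  have [//|s] := Sbig (s := [:: 0; 1]); rewrite !inE negb_or => /andP[s0 s1].
  have [t [ts st]] := Sinv s0.
  apply: (finish s t) => //; rewrite pi !mul0r ?addr0 ?[0 == 1]eq_sym; exact: (eps_neq0 hS).
have b0 : coordinate v i * phi (e i) != 0 by apply: mul_neq0.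
have [c [cb bc]] := Sinv b0.
have [s [s0 s1 sc sT]] := exists_trace Sinv Sbig c.
have [t [ts st]] := Sinv s0.
(* Here c is the inverse of the product of v_i and phi_i. *)
have inv (z : R^c) : phi (e i) * z * coordinate v i = 1 -> z = c.
  move=> E; apply: (Imul b0); rewrite cb; apply: (mulI b0); rewrite mulr1.
  have -> : coordinate v i * phi (e i) * (z * (coordinate v i * phi (e i))) =
    coordinate v i * (phi (e i) * z * coordinate v i) * phi (e i) by rewrite !mulrA.
  by rewrite E mulr1.
apply: (finish s t) => //.
- rewrite addrC addr_eq0; apply: contra_neq sc => E.
  have /inv <- : phi (e i) * - (s - 1) * coordinate v i = 1 by rewrite mulrN mulNr E opprK.
  by rewrite opprK addrC subrK.
- apply: contra_neq (sT t ts st) => /inv <-.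
  rewrite mulrBr mulr1 mulrBl st mul1r opprB opprB addrACA.
  by rewrite [1 + (s - 1)]addrC subrK [1 + (t - 1)]addrC subrK.
Qed.
End Pair.

(** Over a division ring an axis is an atom of the lattice, hence so is its
image. *)
Lemma moved_line_gen g k v : g (axis k) v -> v <> 0 -> (g (axis k) <= cyclic_sub v)%O.
Proof.
move=> gv v0; set X := g^-1%g (cyclic_sub v).
have gX : g X = cyclic_sub v by rewrite aut_KinvE.
have Xk : (X <= axis k)%O by rewrite -(aut_leE g) gX; apply: cyclic_sub_le.
have [x Xx x0] : exists2 x, X x & x <> 0.
  apply: contrapT => h; apply: v0; suff : (\bot%O : submod M) v by [].
  have <- : g X = \bot%O; last by rewrite gX; apply: cyclic_sub_id.
  rewrite -(aut_bot g); congr (aut_fun g _).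
  apply: submod_eqP => x; split=> [Xx|->]; last exact: submod_mem0.
  by apply: contrapT => x0; apply: h; exists x.
rewrite -gX aut_leE; apply: coord_submod_le => l /eqP ->.
have /axisP xE := submod_le_mem Xk Xx.
have a0 : coordinate x k != 0 by apply/eqP => a0; apply: x0; rewrite xE a0 scale0r.
have [b [ba _]] := Sinv a0.
by rewrite -[e k]scale1r -ba -scalerA -xE; apply: submod_scale.
Qed.

(** The dilatations attached to g (axis k) and g (coaxis k) form a pair as
above. The form can be normalised on v because a form that vanishes on
g (coaxis k) and not on e_j cannot vanish on the line g (axis k). *)
Lemma elementary_division g i j k : F g -> i != j -> ~~ (g (axis k) <= coaxis i)%O ->
  ~~ (axis j <= g (coaxis k))%O -> exists2 a, linear_in (elementary i j a) & a != 0.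
Proof.
move=> Fg ij hi hj.
have [v [Av _ vi]] := line_exists hS hi.
have v0 : v <> 0 by move=> v0; move: vi; rewrite v0 (lform0 (coordinate_linform he i)) eqxx.
have nej : ~ g (coaxis k) (e j).
  by move=> ej; move/negP: hj; apply; apply: coord_submod_le => l /eqP->.
have [phi0 [f0 _ B0] phi0j] := covector_exists hS nej.
have [_ top] := conj_complement he g k.
have /submod_joinP[a [b [Aa Bb ejE]]] := top (e j).
have /cyclic_subP[c ac] := submod_le_mem (moved_line_gen Av v0) Aa.
have pv : phi0 v != 0.
  by apply: contra_neq phi0j => E; rewrite ejE (lformD f0) (B0 b Bb) addr0 ac (lformZ f0) E mulr0.
have [z [zp pz]] := Sinv pv.
have z0 : z != 0.
  by apply: contra_neq pv => E; rewrite -[LHS]mulr1 -pz E !mulr0.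
have f1 := lform_mulr f0 z.
apply: (full_pair_elementary ij (v := v) (phi := fun x => phi0 x * z)) => //; last exact: mul_neq0.
split => // s s0; apply: (linear_in_moved_shear hF hHF Fg) Av _.
- exact: lform_mulr.
- by rewrite pz mul1r addrC subrK; apply: invertible_neq0.
- by move=> x /B0->; rewrite !mul0r.
Qed.

End Division.

(** * The net of an intermediate subgroup *)

Section NetOfSubgroup.
Variables (R : pzRingType) (eps : R^c) (hS : simple_artinian eps).
Hypothesis hTwo : two_vectors eps.
Hypothesis hDich : (eps = 1 /\ more_than_six R^c) \/ two_covectors eps.
Variables (M : lmodType R^c) (n : nat) (e : 'I_n -> M) (he : is_basis e).
Implicit Types (A B C : submod M) (x y v : M) (i j k l : 'I_n).
Implicit Types (g u : latAut (submod M)).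

Local Notation axis := (axis he).
Local Notation coaxis := (coaxis he).
Local Notation coordinate := (coordinate he).
Local Notation elementary := (elementary he).
Let epsK := eps_idem hS.

Lemma one_neq0 : (1 : R^c) != 0.
Proof.
by apply/eqP => E; have := eps_neq0 hS; rewrite -[eps]mulr1 E mulr0 eqxx.
Qed.

(** If every j failed, expanding an element of g (axis k) in coordinates
would place it in g (coaxis k). *)
Lemma axis_partner g k : exists j, ~~ (g (axis k) <= coaxis j)%O /\ ~~ (axis j <= g (coaxis k))%O.
Proof.
apply: contrapT => h.
have sub : (g (axis k) <= g (coaxis k))%O.
  apply/submod_leP => x gx; rewrite [x](coordinateE he); apply: submod_sum => j _.
  have [le|nle] := boolP (g (axis k) <= coaxis j)%O.
    by have /coaxisP-> := submod_le_mem le gx; rewrite scale0r; apply: submod_mem0.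
  have [le|nle'] := boolP (axis j <= g (coaxis k))%O; last by case: h; exists j.
  by apply/submod_scale/(submod_le_mem le)/axis_basis.
rewrite aut_leE in sub; have /coaxisP := submod_le_mem sub (axis_basis he k).
by rewrite coordinate_self => /eqP; apply/negP/one_neq0.
Qed.

Fact ideal0_closed : ideal_closed [set 0 : R].
Proof.
split; first by split=> [|x y]; rewrite !inE // => -> ->; rewrite subrr.
by move=> r x; rewrite !inE => ->; rewrite mulr0 mul0r.
Qed.
Definition ideal0 : ideal R := Ideal ideal0_closed.

Lemma ideal_eq (I J : ideal R) : ideal_set I = ideal_set J -> I = J.
Proof.
case: I J => [I pI] [J pJ] /= E; subst J; congr Ideal; exact: Prop_irrelevance.
Qed.

Definition nonzero_ideal (I : ideal R) := `[< exists2 x : R^c, ideal_set I x & x != 0 >].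

Lemma ideal_mem0 (I : ideal R) : ideal_set I 0.
Proof. by have [[I0 _] _] := idealP I; apply: set_mem. Qed.

Lemma nonzero_ideal_all (I : ideal R) : nonzero_ideal I -> forall x : R^c, ideal_set I x.
Proof.
move=> /asboolP ex; have [[I0 IB] IM] := idealP I.
apply: (simple_ideal hS (I := ideal_set I)) => // [x y Ix Iy|x a Ix].
  apply: set_mem; rewrite -[y]opprK; apply: (IB); first exact: mem_set.
  by rewrite -sub0r; apply: (IB) => //; apply: mem_set.
by have [h1 h2] := IM a x (mem_set Ix); split; apply: set_mem.
Qed.

Lemma zero_idealP (I : ideal R) (x : R) : ~~ nonzero_ideal I -> ideal_set I x -> x = 0.
Proof.
move=> /asboolP nI Ix; apply/eqP; apply: contraT => x0; case: nI; by exists x.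
Qed.

Lemma nonzero_idealT : nonzero_ideal (idealT R).
Proof. by apply/asboolP; exists 1 => //; exact: one_neq0. Qed.
Lemma nonzero_ideal0F : ~~ nonzero_ideal ideal0.
Proof. by apply/asboolP => -[x /= ->]; rewrite eqxx. Qed.

Definition cell (sigma : 'I_n -> 'I_n -> ideal R) i :=
  coord_submod he (fun j => nonzero_ideal (sigma j i)).

Lemma smul_nz j (I : ideal R) : smul (e j) I = if nonzero_ideal I then axis j else \bot%O.
Proof.
case: ifP => [/nonzero_ideal_all h|/negbT nI]; apply: submod_eqP => x; split.
- by move=> [a _ <-]; apply: axisZ.
- by move=> /axisP->; exists (coordinate x j).
- by move=> [a Ia <-]; rewrite (zero_idealP nI Ia) scale0r.
- by move=> ->; exists 0; [apply: ideal_mem0|rewrite scale0r].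
Qed.

(** Ideals being 0 or R, the j-th summand is 0 or the j-th axis. *)
Lemma cellE sigma i : (\join_(j < n) smul (e j) (transpose_net sigma i j))%O = cell sigma i.
Proof.
rewrite /cell coord_submod_joinE [RHS]big_mkcond; apply: eq_bigr => j _; exact: smul_nz.
Qed.

Lemma pstabKE sigma g : pstab (K e sigma) g <-> forall i, g (cell sigma i) = cell sigma i.
Proof.
split=> [gs i|gk]; first by rewrite -cellE; apply: gs; apply: sub_gen; exists i.
by apply: pstab_gen => _ [i _ <-]; rewrite cellE.
Qed.

Lemma Dnet_nz sigma : Dnet sigma -> (forall i, nonzero_ideal (sigma i i)) /\
  (forall i l j, nonzero_ideal (sigma i l) -> nonzero_ideal (sigma l j) ->
    nonzero_ideal (sigma i j)).
Proof.
move=> [sM s1]; split=> [i|i l j /nonzero_ideal_all h1 /nonzero_ideal_all h2];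
  first by rewrite s1; apply: nonzero_idealT.
apply/asboolP; exists 1; last exact: one_neq0.
apply: (sM i l j); exists 1%N, (fun=> 1), (fun=> 1); split=> //.
by rewrite big_ord_recl big_ord0 addr0 mul1r.
Qed.

Lemma elementary_aut i j a : i != j -> exists2 g, induces g (elementary i j a) &
  forall A, A (e i) \/ (forall x, A x -> coordinate x j = 0) -> g A = A.
Proof.
move=> ij; have fo := lform_mulr (coordinate_linform he j) a.
have [|g gi gA] := shear_aut fo (v := e i).
  by rewrite coordinate_other // mul0r addr0; apply: invertible1.
exists g => // A [Ai|A0]; apply: gA; [by left|right=> x /A0 ->]; exact: mul0r.
Qed.

(** A transvection t from e_j to e_i in G(K_sigma') normalises G(K_sigma).
The latter contains the block diagonal maps, which therefore fix the image by t
of the cell of j. That image contains e_j + e_i; a map on block i then puts a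
nonzero multiple of e_i into the cell of j, that is sigma i j is nonzero. *)
Lemma net_le_of_sandwich sigma sigma' (F : set (latAut (submod M))) : Dnet sigma -> Dnet sigma' ->
  pstab (K e sigma') `<=` F -> F `<=` normaliser (pstab (K e sigma)) ->
  forall i j, nonzero_ideal (sigma' i j) -> nonzero_ideal (sigma i j).
Proof.
move=> /Dnet_nz[s1 sM] /Dnet_nz[s1' sM'] sF Fn i j nz'.
have [->|ij] := eqVneq i j; first exact: s1.
apply: contraT => nz.
have [gt gti gtA] := elementary_aut 1 ij.
have Pt : pstab (K e sigma') gt.
  apply/pstabKE => k; apply: gtA; have [jk|jk] := boolP (nonzero_ideal (sigma' j k)).
    by left; apply: coord_submod_basis; apply: sM' jk.
  by right=> x /coord_submodP; apply.
have Nt := Fn _ (sF _ Pt).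
have [l [m [el l0 me em u]]] := corner_choice hS hTwo epsK (eps_neq0 hS).
have fo := lform_mulr (coordinate_linform he i) m.
have [|gd gdi gdA] := shear_aut fo (v := l *: e i).
  by rewrite coordinateZ coordinate_self mulr1.
have Pd : pstab (K e sigma) gd.
  apply/pstabKE => k; apply: gdA; have [ik|ik] := boolP (nonzero_ideal (sigma i k)).
    by left; apply/submod_scale/coord_submod_basis.
  by right=> x /coord_submodP-> //; rewrite mul0r.
have /pstabKE/(_ j) : pstab (K e sigma) (gd ^ gt)%g by rewrite -Nt; exists gd.
set A := cell sigma j; rewrite /conjg !aut_mulE => /(congr1 gt); rewrite aut_KinvE => E.
have Aj : A (e j) by apply: coord_submod_basis.
have t1 : elementary i j 1 (e j) = e j + e i
  by rewrite /elementary /shear coordinate_self mul1r scale1r.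
have := Aj; rewrite (gti A) t1 => Bij.
have := Bij; rewrite (gdi (gt A)) E /shear coordinateD coordinate_other 1?eq_sym // coordinate_self add0r mul1r.
move=> /submod_sub/(_ Bij); rewrite addrC addKr scalerA => Bml.
have : A ((m * l) *: e i).
  by rewrite (gti A) /elementary /shear coordinateZ coordinate_other // mulr0 mul0r scale0r addr0.
move=> /coord_submodP/(_ i nz); rewrite coordinateZ coordinate_self mulr1 => /eqP ml; exfalso;
  move: ml; apply/negP.
rewrite -{1}me; apply: (eps_mul_neq0 hS) => //; last exact: eps_neq0.
by apply: contra_neq (eps_neq0 hS) => m0; rewrite -em m0 mulr0.
Qed.

Section Subgroup.
Variables (F : set (latAut (submod M))).
Hypothesis hF : subgroup F.
Hypothesis hHF : pstab (L0 e) `<=` F.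
Local Notation linear_in := (linear_in F).

(** The step that replaces computations with matrix entries: if g is
thought of as a matrix, the hypotheses say that its entry (i, k) and the entry
(k, j) of its inverse are nonzero. *)
Lemma elementary_of_moved_axis g i j k : F g -> i != j -> ~~ (g (axis k) <= coaxis i)%O ->
  ~~ (axis j <= g (coaxis k))%O -> forall a, linear_in (elementary i j a).
Proof.
move=> Fg ij hi hj; apply: (linear_in_elementary_all hS hF hHF ij).
case: hDich => [[e1 big]|hB]; last exact: (elementary_higher_rank hS hTwo hF hHF hB Fg ij hi hj).
move: hS hTwo; rewrite e1 => hS1 hTwo1.
exact: (elementary_division hS1 hTwo1 big hF hHF Fg ij hi hj).
Qed.

Definition netrel i j := (i == j) || `[< forall a, linear_in (elementary i j a) >].

Lemma netrel_refl : reflexive netrel. Proof. by move=> i; rewrite /netrel eqxx. Qed.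

Lemma netrelP i j : netrel i j -> i != j -> forall a, linear_in (elementary i j a).
Proof. by move=> /predU1P[->|/asboolP//]; rewrite eqxx. Qed.

(** The commutator relation between elementary transvections. *)
Lemma netrel_trans : transitive netrel.
Proof.
move=> j i k rij rjk; rewrite /netrel.
have [//|ik] := eqVneq i k; apply/asboolP => a.
have [E|ij] := eqVneq i j; first by move: ik; rewrite E => jk; apply: netrelP.
have [E|jk] := eqVneq j k; first by rewrite -E; apply: netrelP.
have fj := lform_mulr (coordinate_linform he j) (1 : R^c).
have fk := lform_mulr (coordinate_linform he k) a.
have u : invertible (1 + coordinate (e i) j * 1) by rewrite coordinate_other // mul0r addr0;
  apply: invertible1.
have w : 1 * (1 + coordinate (e j) k * a) = 1 by rewrite coordinate_other // mul0r addr0 mul1r.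
have := linear_in_commutator_covector hF fj u fk w (netrelP rij ij 1) (netrelP rjk jk a).
rewrite coordinate_other // mul0r => /(_ erefl); congr linear_in.
by rewrite coordinate_self !mulr1 /elementary; congr shear; apply/funext => x; rewrite mulr1.
Qed.

Local Notation down := (down he netrel).

(** For q below s and an index i at which g (axis q) has a nonzero
coordinate, i is below j: apply elementary_of_moved_axis to the axis of s under
g, or, if its i-th coordinates vanish, under g composed with the transvection
from e_s to e_q, which makes them nonzero and leaves coaxis s in place. *)
Lemma moved_down_le g s j : F g -> ~~ (g (axis s) <= coaxis j)%O ->
  ~~ (axis j <= g (coaxis s))%O -> (g (down s) <= down j)%O.
Proof.
move=> Fg hs hj; rewrite /down coord_submod_joinE aut_bigjoin; apply/joinsP => q rqs.
apply/submod_leP => x gx; apply/coord_submodP => i rij; apply/coaxisP; apply: submod_le_mem gx.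
apply: contraNT rij => hq.
have [->|ij] := eqVneq i j; first exact: netrel_refl.
rewrite /netrel; apply/orP; right; apply/asboolP.
have [le|nle] := boolP (g (axis s) <= coaxis i)%O;
  last exact: elementary_of_moved_axis Fg ij nle hj.
have qs : q != s by apply: contraNneq hq => ->.
have fo := lform_mulr (coordinate_linform he s) (1 : R^c).
have u : invertible (1 + coordinate (e q) s * 1) by rewrite coordinate_other // mul0r addr0;
  apply: invertible1.
(* The transvection from e_s to e_q. *)
have [gt [Fgt gti gtA]] := linear_in_shear_aut fo u (netrelP rqs qs 1).
have t1 : shear (e q) (fun x => coordinate x s * 1) (e s) = e s + e q.
  by rewrite /shear coordinate_self mul1r scale1r.
apply: (@elementary_of_moved_axis (g * gt)%g i j s _ ij); first exact: subgroupM.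
- rewrite aut_mulE; apply: contra hq => le2.
  have sub : (axis q <= gt (axis s) `|` axis s)%O.
    apply: coord_submod_le => l /eqP->; apply/submod_joinP; exists (e s + e q), (- e s); split.
    + by rewrite -t1 -gti; apply: axis_basis.
    + by apply/submod_opp/axis_basis.
    + by rewrite addrC addKr.
  rewrite -(aut_leE g) aut_join in sub; apply: le_trans sub _.
  by rewrite leUx le2 le.
- rewrite aut_mulE gtA //; left; apply/coaxisP; exact: coordinate_other.
Qed.

(** The two conditions on j are exchanged when g is replaced by its inverse
and s by j, so the previous inclusion also holds in the other direction. Thus F
permutes the generators of the lattice of the net. *)
Lemma moved_down g s : F g -> exists j, g (down s) = down j.
Proof.
move=> Fg; have [j [h1 h2]] := axis_partner g s; exists j.
apply/le_anti; rewrite (moved_down_le Fg) //=.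
rewrite -[X in (X <= _)%O](aut_KinvE g) aut_leE; apply: moved_down_le.
- exact: subgroupV.
- by rewrite -(aut_leE g) aut_KinvE.
- by rewrite -(aut_leE g) aut_KinvE.
Qed.

Definition net i j : ideal R := if netrel i j then idealT R else ideal0.

Lemma net_nz i j : nonzero_ideal (net i j) = netrel i j.
Proof. by rewrite /net; case: ifP => _; [exact: nonzero_idealT|exact/negbTE/nonzero_ideal0F]. Qed.

Lemma net_cell i : cell net i = down i.
Proof. by apply: eq_coord_submod => j; apply: net_nz. Qed.

Lemma net_Dnet : Dnet net.
Proof.
split=> [i l j x [k [a [b [ab ->]]]]|i]; last by rewrite /net netrel_refl.
rewrite /net; case: ifP => // /negbT nij; rewrite big1 // => q _.
have [] := ab q; rewrite /net; case: ifP => [il _|_ -> _]; last by rewrite mul0r.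
case: ifP => [lj|_ ->]; last by rewrite mulr0.
by case/negP: nij; apply: netrel_trans lj.
Qed.

Lemma net_lower : pstab (K e net) `<=` F.
Proof.
move=> g /pstabKE gK; apply: (fixdown_sub hS hF hHF netrel_refl netrel_trans netrelP) => s.
by rewrite -net_cell.
Qed.

(** An element of F permutes the submodules whose common stabiliser is
G(K_sigma). *)
Lemma net_upper : F `<=` normaliser (pstab (K e net)).
Proof.
have conj g h : F g -> pstab (K e net) h -> pstab (K e net) (h ^ g)%g.
  move=> Fg /pstabKE hK; apply/pstabKE => s; rewrite net_cell /conjg !aut_mulE.
  have [j gj] := moved_down s Fg.
  by rewrite gj -net_cell hK net_cell -gj aut_invKE.
move=> g Fg; apply/seteqP; split=> [_ [h hK <-]|h hK]; first exact: conj.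
exists (h ^ g^-1)%g; first by apply: conj => //; apply: subgroupV.
by apply: latAut_ext => A; rewrite /conjg !aut_mulE (aut_KinvE g^-1%g) (aut_invKE g).
Qed.

Theorem sandwich_exists_unique : exists! sigma : 'I_n -> 'I_n -> ideal R,
  Dnet sigma /\ pstab (K e sigma) `<=` F /\ F `<=` normaliser (pstab (K e sigma)).
Proof.
exists net; split; first by split; [exact: net_Dnet|split; [exact: net_lower|exact: net_upper]].
move=> sigma [sD [sl su]]; apply/funext => i; apply/funext => j.
have h1 := net_le_of_sandwich sD net_Dnet net_lower su (i := i) (j := j).
have h2 := net_le_of_sandwich net_Dnet sD sl net_upper (i := i) (j := j).
apply/ideal_eq/seteqP; have [nz|nz] := boolP (nonzero_ideal (net i j)).
  by split=> x _; apply: nonzero_ideal_all => //; apply: h1.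
have nz' : ~~ nonzero_ideal (sigma i j) by apply: contra nz.
by split=> x /zero_idealP ->//; apply: ideal_mem0.
Qed.
End Subgroup.
End NetOfSubgroup.

(** * Finite division rings and the excluded rings *)

Lemma onth_index (T : eqType) (s : seq T) : (forall x, x \in s) ->
  pcancel (index^~ s) (onth s).
Proof.
move=> sT x; move: {sT}(sT x); elim: s => //= y s IH; rewrite inE eq_sym.
by case: eqVneq => [->//|_ /= /IH].
Qed.

(** The order is a power of the characteristic. *)
Lemma card_finField_neq6 (F : finFieldType) : #|F| <> 6%N.
Proof.
have [p pr_p pF] := finPcharP F.
have := card_pprimeChar pF; set k := logn _ _ => E E6; move: E; rewrite [LHS]E6 => E.
have d2 : (2 %| p ^ k)%N by rewrite -E.
have d3 : (3 %| p ^ k)%N by rewrite -E.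
move: d2 d3; rewrite !Euclid_dvdX // => /andP[d2 _] /andP[d3 _].
by move: d2 d3; rewrite !dvdn_prime2 // => /eqP <-.
Qed.

(** Wedderburn's little theorem, for the finite type structure read off
from a list of all the elements. *)
Lemma listed_field (T : unitRingType) (hT : forall x : T, x != 0 -> x \is a GRing.unit)
    (s : seq T) : (forall x, x \in s) ->
  exists F : finFieldType, (#|F| <= size s)%N /\ exists f : {rmorphism T -> F}, bijective f.
Proof.
move=> sT.
pose cT : countType := HB.pack T (PCanIsCountable (onth_index sT)).
have ax : Finite.axiom (undup s : seq cT).
  by move=> x; rewrite count_uniq_mem ?undup_uniq // mem_undup sT.
pose fT : finUnitRingType := HB.pack T (PCanIsCountable (onth_index sT)) (isFinite.Build cT ax).
have dom : GRing.integral_domain_axiom fT.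
  move=> x y xy; apply/norP => -[x0 y0].
  by case/eqP: y0; apply: (mulrI (hT x x0)); rewrite mulr0.
pose F := FinDomainFieldType dom.
have h1 : (#|F| <= size s)%N.
  rewrite cardE; apply: leq_trans (size_undup s).
  by apply: uniq_leq_size (enum_uniq _) _ => x _; rewrite mem_undup.
exists F; split => //.
by exists (idfun : {rmorphism T -> T}); exists idfun.
Qed.

Section SmallCases.
Variables (T : unitRingType) (hT : forall x : T, x != 0 -> x \is a GRing.unit).

Lemma seven_scalars : ~ exceptional_ring 'M[T]_1 -> more_than_six T.
Proof.
move=> hR s s6; apply: contrapT => h; apply: hR; left.
have sT x : x \in s by apply: contraT => xs; exfalso; apply: h; exists x.
have [F [Fs [f [g fg gf]]]] := listed_field hT sT.
exists F; split.
  have := leq_trans Fs s6; have := card_finField_neq6 (F := F); have := finNzRing_gt1 F.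
  by case: #|F| => [|[|[|[|[|[|[|k]]]]]]].
have add (A B : 'M[T]_1) : f ((A - B) 0 0) = f (A 0 0) - f (B 0 0) by rewrite !mxE rmorphB.
have mul : GRing.monoid_morphism (fun A : 'M[T]_1 => f (A 0 0)).
  split; first by rewrite mxE eqxx rmorph1.
  by move=> A B /=; rewrite mxE big_ord1 rmorphM.
pose za := GRing.isZmodMorphism.Build _ _ (fun A : 'M[T]_1 => f (A 0 0)) add.
pose zm := GRing.isMonoidMorphism.Build _ _ (fun A : 'M[T]_1 => f (A 0 0)) mul.
pose phi : {rmorphism 'M[T]_1 -> F} := HB.pack (fun A : 'M[T]_1 => f (A 0 0)) za zm.
exists phi; exists (fun x => (g x)%:M) => [A|x]; last by rewrite /= mxE mulr1n gf.
by rewrite /= fg; apply/matrixP => i j; rewrite !ord1 mxE.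
Qed.

Lemma third_scalar : ~ exceptional_ring 'M[T]_2 -> exists b : T, b != 0 /\ b != 1.
Proof.
move=> hR; apply: contrapT => h; apply: hR; right.
have sT (x : T) : x \in [:: 0; 1].
  apply: contraT; rewrite !inE negb_or => /andP[x0 x1]; exfalso; apply: h; by exists x.
have [F [Fs [f [g fg gf]]]] := listed_field hT sT.
exists F; split; first by apply/eqP; rewrite eqn_leq Fs finNzRing_gt1.
exists (map_mx f); exists (map_mx g) => A; apply/matrixP => i j; by rewrite !mxE.
Qed.
End SmallCases.

(** * Full matrix rings over a skew field *)

Section Matrices.
Variables (T : unitRingType) (hT : forall x : T, x != 0 -> x \is a GRing.unit).
Variables (m : nat) (o : 'I_m).
Implicit Types (a b c d : 'I_m) (s t : T) (A B : 'M[T]_m).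

Definition unitmat a b t : 'M[T]_m := \matrix_(i, j) (if (i == a) && (j == b) then t else 0).

Lemma unitmat_mulE a b t A i j : (unitmat a b t *m A) i j = if i == a then t * A b j else 0.
Proof.
rewrite mxE (bigD1 b) //= big1 ?addr0 => [|k /negPf kb]; rewrite !mxE ?eqxx ?kb andbC //=.
  by case: (i == a); rewrite ?mul0r.
by rewrite mul0r.
Qed.

Lemma mul_unitmatE a b t A i j : (A *m unitmat a b t) i j = if j == b then A i a * t else 0.
Proof.
rewrite mxE (bigD1 a) //= big1 ?addr0 => [|k /negPf ka]; rewrite !mxE ?eqxx ?ka //=.
  by case: (j == b); rewrite ?mulr0.
by rewrite mulr0.
Qed.

Lemma unitmat_mul a b c s t : unitmat a b s *m unitmat b c t = unitmat a c (s * t).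
Proof.
apply/matrixP => i j; rewrite unitmat_mulE !mxE eqxx /=.
by case: (i == a); case: (j == c); rewrite //= mulr0.
Qed.

Lemma unitmat_mul0 a b b' c s t : b != b' -> unitmat a b s *m unitmat b' c t = 0.
Proof.
move=> /negPf bb; apply/matrixP => i j; rewrite unitmat_mulE !mxE bb /= mulr0.
by case: ifP.
Qed.

Lemma unitmat_eq0 a b t : (unitmat a b t == 0) = (t == 0).
Proof.
apply/eqP/eqP => [/matrixP/(_ a b)|->]; first by rewrite !mxE !eqxx.
by apply/matrixP => i j; rewrite !mxE; case: ifP.
Qed.

Lemma unitmat_inj a b : injective (unitmat a b).
Proof. by move=> s t /matrixP/(_ a b); rewrite !mxE !eqxx. Qed.

Lemma matrix_sum_unitmat A : A = \sum_i \sum_j unitmat i j (A i j).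
Proof.
apply/matrixP => i j; rewrite summxE (bigD1 i) //= [X in _ + X]big1 ?addr0 => [|k ki].
  rewrite summxE (bigD1 j) //= big1 ?addr0 => [|k kj]; rewrite mxE ?eqxx //.
  by rewrite eq_sym (negPf kj) andbF.
by rewrite summxE big1 // => l _; rewrite mxE eq_sym (negPf ki).
Qed.

Definition epsm : ('M[T]_m)^c := unitmat o o 1.

Lemma corner_unitmat A : unitmat o o 1 *m A *m unitmat o o 1 = unitmat o o (A o o).
Proof.
apply/matrixP => i j; rewrite mul_unitmatE unitmat_mulE !mxE mul1r.
by case: (j == o); case: (i == o); rewrite //= ?mulr1 ?mul0r.
Qed.

Lemma other_index : (1 < m)%N -> forall a, exists b, b != a.
Proof.
move=> m1 a; have : (1 < #|'I_m|)%N by rewrite card_ord.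
by rewrite (cardD1 a) inE add1n ltnS => /card_gt0P[b]; rewrite !inE andbT; exists b.
Qed.

Lemma index_unique a b : (m <= 1)%N -> a = b.
Proof.
move=> m1; apply/ord_inj; have := leq_trans (ltn_ord a) m1.
by have := leq_trans (ltn_ord b) m1; rewrite !ltnS !leqn0 => /eqP-> /eqP->.
Qed.

(** Off-diagonal matrix units are differences of two units, and diagonal
ones are products of off-diagonal ones. In size one, every nonzero scalar is a
unit. *)
Lemma unitmat_span (P : 'M[T]_m -> Prop) :
  (forall u, (exists w, w *m u = 1%:M /\ u *m w = 1%:M) -> P u) ->
  (forall x y, P x -> P y -> P (x - y)) ->
  (forall x y, P x -> P y -> P (x *m y)) -> forall x, P x.
Proof.
move=> Pu PB PM x.
have P1 : P 1%:M by apply: Pu; exists 1%:M; rewrite mulmx1.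
have P0 : P 0 by rewrite -(subrr 1%:M); apply: (PB).
have PD A B : P A -> P B -> P (A + B).
  by move=> PA HB; rewrite -[B]opprK; apply: (PB) => //; rewrite -sub0r; apply: (PB).
have Poff a b t : a != b -> P (unitmat a b t).
  move=> ab; rewrite -[unitmat a b t](addKr 1%:M) addrC; apply: (PB) => //.
  have sq s s' : unitmat a b s *m unitmat a b s' = 0 by rewrite unitmat_mul0 // eq_sym.
  have un s s' : s + s' = 0 -> (1%:M + unitmat a b s) *m (1%:M + unitmat a b s') = 1%:M.
    move=> ss; rewrite mulmxDl !mulmxDr !mulmx1 !mul1mx sq addr0 -addrA.
    have -> : unitmat a b s' + unitmat a b s = 0; last by rewrite addr0.
    rewrite -[unitmat a b s]opprK; apply/eqP; rewrite subr_eq0; apply/eqP/matrixP => i j.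
    rewrite !mxE; case: ifP; rewrite ?oppr0 // => _.
    by apply/eqP; rewrite -addr_eq0 addrC ss.
  by apply: Pu; exists (1%:M + unitmat a b (- t)); split; apply: un; rewrite ?addNr ?subrr.
rewrite [x]matrix_sum_unitmat; elim/big_ind: _ => // i _; elim/big_ind: _ => // j _.
move: (x i j) => t; have [<-|ij] := eqVneq i j; last exact: Poff.
case: (ltnP 1 m) => m1.
  have [k ki] := other_index m1 i.
  by rewrite -[t]mulr1 -(unitmat_mul i k); apply: PM; apply: Poff; rewrite // eq_sym.
have i1 k : k = i by apply: index_unique.
have [->|/hT ut] := eqVneq t 0; first by have /eqP -> : unitmat i i 0 == 0 by rewrite unitmat_eq0.
have E1 : 1%:M = unitmat i i 1.
  by apply/matrixP => k l; rewrite (i1 k) (i1 l) !mxE !eqxx.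
by apply: Pu; exists (unitmat i i t^-1); rewrite !unitmat_mul mulVr ?mulrV.
Qed.

Lemma matrix_simple : simple_artinian epsm.
Proof.
split.
- by rewrite -[LHS]/(unitmat o o 1 *m unitmat o o 1) unitmat_mul mulr1.
- by rewrite unitmat_eq0 oner_neq0.
- move=> x; have cE (y : ('M[T]_m)^c) : epsm * y * epsm = unitmat o o ((y : 'M_m) o o).
    by rewrite -[LHS]/(unitmat o o 1 *m (y *m unitmat o o 1)) mulmxA corner_unitmat.
  rewrite cE unitmat_eq0 => /hT ux.
  exists (unitmat o o ((x : 'M_m) o o)^-1); rewrite !cE.
  have -> : unitmat o o ((x : 'M_m) o o)^-1 o o = ((x : 'M_m) o o)^-1 by rewrite mxE !eqxx.
  split; [rewrite -[LHS]/(unitmat o o _ *m unitmat o o _)|rewrite -[LHS]/(unitmat o o _ *m unitmat o o _)].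
    by rewrite unitmat_mul mulrV.
  by rewrite unitmat_mul mulVr.
- exists m, (fun a => unitmat o a 1), (fun a => unitmat a o 1).
  transitivity (\sum_a unitmat a a 1).
    apply/matrixP => i j; rewrite [LHS]mxE summxE (bigD1 i) //= big1 ?addr0 => [|k ki].
      by rewrite mxE eqxx /= eq_sym; case: ifP.
    by rewrite mxE eq_sym (negPf ki).
  apply: eq_bigr => a _; rewrite -[RHS]/(unitmat a o 1 *m (unitmat o o 1 *m unitmat o a 1)).
  by rewrite !unitmat_mul !mulr1.
- move=> P Pu PB PM; apply: unitmat_span => //.
  + by move=> u [w [w1 w2]]; apply: Pu; exists w.
  + by move=> x y Px Py; exact: (PM y x Py Px).
Qed.

Lemma matrix_two_vectors : (1 < m)%N \/ (exists t : T, t != 0 /\ t != 1) ->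
  two_vectors epsm.
Proof.
have el a t : epsm * (unitmat a o t : ('M[T]_m)^c) = unitmat a o t.
  by rewrite -[LHS]/(unitmat a o t *m unitmat o o 1) unitmat_mul mulr1.
move=> [m1|[t [t0 t1]]].
  have [b bo] := other_index m1 o.
  exists (unitmat o o 1), (unitmat b o 1); split; rewrite ?unitmat_eq0 ?oner_neq0 ?el //.
  apply/eqP => /matrixP/(_ b o); rewrite !mxE !eqxx (negPf bo) /= => /eqP.
  by rewrite eq_sym oner_eq0.
exists (unitmat o o 1), (unitmat o o t); split; rewrite ?unitmat_eq0 ?oner_neq0 ?el //.
by rewrite (inj_eq (@unitmat_inj o o)) eq_sym.
Qed.

(** A column c is orthogonal to the rows that have t in column b and
- t c_b / c_a in column a, where c_a is a nonzero entry of c. Varying b gives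
two of them when the size is at least three, and varying t when it is two. *)
Lemma matrix_two_covectors : (2 < m)%N \/ ((1 < m)%N /\ exists t : T, t != 0 /\ t != 1) ->
  two_covectors epsm.
Proof.
move=> hm c ec.
have cj i j : j != o -> (c : 'M_m) i j = 0.
  move=> jo; have /matrixP/(_ i j) : (c : 'M_m) *m unitmat o o 1 = c by [].
  by rewrite mul_unitmatE (negPf jo).
(* If c = 0, any a does: the entries c_b vanish as well. *)
have [a ha] : exists a, forall b, (c : 'M_m) b o = (c : 'M_m) b o * ((c : 'M_m) a o)^-1
  * (c : 'M_m) a o.
  have [[a ca]|h] := pselect (exists a, (c : 'M_m) a o != 0).
    by exists a => b; rewrite divrK // hT.
  exists o => b; have -> : (c : 'M_m) b o = 0; last by rewrite !mul0r.
  by apply/eqP; apply: contraT => cb; exfalso; apply: h; exists b.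
pose rho b t : 'M[T]_m := unitmat o b t - unitmat o a (t * ((c : 'M_m) b o * ((c : 'M_m) a o)^-1)).
have rc b t : rho b t *m (c : 'M_m) = 0.
  apply/matrixP => i j; rewrite mulmxBl [LHS]mxE [X in _ + X]mxE !unitmat_mulE mxE.
  case: (i == o); last by rewrite subr0.
  have [->|jo] := eqVneq j o; last by rewrite !(cj _ _ jo) !mulr0 subr0.
  by rewrite -[t * _ * _]mulrA -ha subrr.
have re b t : unitmat o o 1 *m rho b t = rho b t.
  by rewrite mulmxBr !unitmat_mul !mul1r.
have rE b t k : k != a -> rho b t o k = if k == b then t else 0.
  by move=> ka; rewrite !mxE eqxx (negPf ka) subr0.
have key b b' t t' : b != a -> b' != a -> t != 0 -> t' != 0 -> (b != b') || (t != t') ->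
  exists m1 m2 : ('M[T]_m)^c,
    [/\ m1 != m2, m1 != 0, m2 != 0, m1 * epsm = m1 & m2 * epsm = m2] /\
    c * m1 = 0 /\ c * m2 = 0.
  move=> ba ba' t0 t0' neq; exists (rho b t), (rho b' t'); split; last by split; exact: rc.
  split; last by exact: re.
  - apply/eqP => /matrixP/(_ o b); rewrite !rE // eqxx.
    case: eqVneq neq => [_ /= tt' E|_ _ E]; first by rewrite E eqxx in tt'.
    by rewrite E eqxx in t0.
  - by apply/eqP => /matrixP/(_ o b); rewrite rE // eqxx mxE => E; rewrite E eqxx in t0.
  - by apply/eqP => /matrixP/(_ o b'); rewrite rE // eqxx mxE => E; rewrite E eqxx in t0'.
  - exact: re.
case: hm => [m2|[m1 [t [t0 t1]]]].
  have [b ba] := other_index (ltnW m2) a.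
  have [b' /andP[bb' ba']] : exists b', (b' != b) && (b' != a).
    have : (2 < #|'I_m|)%N by rewrite card_ord.
    rewrite (cardD1 a) (cardD1 b) !inE ba !add1n !ltnS => /card_gt0P[b'].
    by rewrite !inE andbT => h; exists b'.
  by apply: (key b b' 1 1) => //; rewrite ?oner_neq0 // eq_sym bb'.
have [b ba] := other_index m1 a.
by apply: (key b b 1 t) => //; rewrite ?oner_neq0 // eqxx eq_sym.
Qed.

Lemma matrix_seven_elements : m = 1%N -> more_than_six T ->
  epsm = 1 /\ more_than_six ('M[T]_m)^c.
Proof.
move=> m1 big; split.
  apply/matrixP => i j; have io k : k = o by apply: index_unique; rewrite m1.
  by rewrite (io i) (io j) !mxE !eqxx.
move=> s s6; have [|x xs] := big [seq (A : 'M[T]_m) o o | A <- s]; first by rewrite size_map.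
exists (unitmat o o x); apply: contra xs => xs.
by apply/mapP; exists (unitmat o o x) => //; rewrite mxE !eqxx.
Qed.
End Matrices.

Theorem theorem1 (T : unitRingType)
    (hT : forall x : T, x != 0 -> x \is a GRing.unit)
    (m : nat) (hm : (1 <= m)%N)
    (hR : ~ exceptional_ring 'M[T]_m)
    (n : nat) (hn : (2 <= n)%N)
    (M : lmodType (GRing.converse 'M[T]_m)) (e : 'I_n -> M) (he : is_basis e)
    (F : set (latAut (submod M))) (hF : subgroup F)
    (hHF : pstab (L0 e) `<=` F) :
  exists! sigma : 'I_n -> 'I_n -> ideal 'M[T]_m,
    Dnet sigma /\
    pstab (K e sigma) `<=` F /\ F `<=` normaliser (pstab (K e sigma)).
Proof.
pose o := Ordinal hm.
apply: (sandwich_exists_unique (matrix_simple hT o)) => //.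
- apply: matrix_two_vectors => //; case: (ltngtP m 1) => [m0|_|m1];
    [by rewrite ltnNge hm in m0|by left|right].
  have hR1 : ~ exceptional_ring 'M[T]_1 by rewrite -m1.
  have [//|b] := seven_scalars hT hR1 (s := [:: 0; 1]).
  by rewrite !inE negb_or => /andP[b0 b1]; exists b.
- case: (ltngtP m 1) => [m0|m2|m1]; [by rewrite ltnNge hm in m0|right|left].
    apply: matrix_two_covectors => //; case: (ltngtP m 2) => [m1|_|E];
      [by rewrite ltnNge m2 in m1|by left|right].
    by split => //; apply: (third_scalar hT); rewrite -E.
  by apply: matrix_seven_elements => //; apply: seven_scalars => //; rewrite -m1.
Qed.
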